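(* Assume that the design points $x_1<\cdots<x_n$ are drawn from a continuous distribution on $[0,1]$, and that the responses follow the model $$y_i=f_0(x_i)+\epsilon_i,\quad i=1,\ldots,n,$$ for uniformly sub-Gaussian errors $\epsilon_i$, $i=1,\ldots,n$, with mean zero and unit variance, independent of the design points. Further assume that $f_0$ has two weak derivatives and that $\int_0^1(D^2f_0)(x)^2\,dx\le C_n^2$ for some $C_n\ge1$. Then there are universal constants $c_1,c_2,c_3,n_0>0$ such that for all $c\ge c_1$ and $n\ge n_0$, the weighted cubic Bohlmann-Whittaker filtering solution $$\hat\theta=\mathop{\mathrm{argmin}}_{\theta\in\mathbb{R}^n}\;\|y-\theta\|_2^2+\lambda\sum_{i=1}^{n-2}(\mathbb{D}^2_n\theta)_i^2\cdot\frac{x_{i+2}-x_i}{2}$$ with $\lambda=3cn^{\frac15}C_n^{-\frac85}$ satisfies $$\frac1n\big\|\hat\theta-f_0(x_{1:n})\big\|_2^2\le26\,c\,n^{-\frac45}C_n^{\frac25}$$ with probability at least $1-\exp(-c_2c)-\exp(-c_3\sqrt n)$.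
   Context: $f_0(x_{1:n})=(f_0(x_1),\ldots,f_0(x_n))$. The design points are the order statistics of $n$ i.i.d. draws from a continuous distribution on $[0,1]$ (hence almost surely distinct). The errors are independent of each other and uniformly sub-Gaussian: there is a fixed constant $K$ with $\mathbb{E}e^{t\epsilon_i}\le e^{K^2t^2/2}$ for all $t\in\mathbb{R}$ and all $i$; ''universal'' constants may depend on $K$ but not on $n$, $c$, $C_n$, $f_0$, or the distribution of the design points. $\mathbb{D}^2_n\in\mathbb{R}^{(n-2)\times n}$ is the second order discrete derivative matrix: $(\mathbb{D}^2_n\theta)_i=\frac{2}{x_{i+2}-x_i}\Big(\frac{\theta_{i+2}-\theta_{i+1}}{x_{i+2}-x_{i+1}}-\frac{\theta_{i+1}-\theta_i}{x_{i+1}-x_i}\Big)$. *)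

(* Defs.v *)
From HB Require Import structures.
From mathcomp Require Import all_boot all_order all_algebra.
From mathcomp Require Import all_classical all_reals all_analysis.
Import Order.TTheory GRing.Theory Num.Theory.
Import numFieldNormedType.Exports.

Set Implicit Arguments.
Unset Strict Implicit.
Unset Printing Implicit Defensive.

Local Open Scope classical_set_scope.
Local Open Scope ring_scope.

Section Vectors.
Context {R : realType}.
Implicit Types n : nat.

Definition sqnorm2 n (v : 'cV[R]_n) : R := \sum_(i < n) v i 0 ^+ 2.

Lemma offset_subproof n k (hk : (k <= 2)%N) (i : 'I_(n - 2)) : (i + k < n)%N.
Proof.
have := ltn_ord i; rewrite ltn_subRL addnC; apply: leq_ltn_trans.
by rewrite leq_add2l.
Qed.

Definition offset n k (hk : (k <= 2)%N) (i : 'I_(n - 2)) : 'I_n :=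
  Ordinal (offset_subproof hk i).

Local Notation elt v i k := (v (@offset _ k isT i) 0) (only parsing).

(* The second order discrete derivative of theta at the points x. Where x has
   ties the divisions by zero return junk; it is only used for strictly
   increasing x. *)
Definition discrete_deriv2 n (x theta : 'cV[R]_n) : 'cV[R]_(n - 2) :=
  \col_(i < n - 2)
    (2 / (elt x i 2 - elt x i 0) *
     ((elt theta i 2 - elt theta i 1) / (elt x i 2 - elt x i 1) -
      (elt theta i 1 - elt theta i 0) / (elt x i 1 - elt x i 0))).

Definition bw_criterion n (lambda : R) (x y theta : 'cV[R]_n) : R :=
  sqnorm2 (y - theta) +
  lambda * \sum_(i < n - 2)
    (discrete_deriv2 x theta i 0) ^+ 2 * ((elt x i 2 - elt x i 0) / 2).

Definition strictly_increasing n (x : 'cV[R]_n) : Prop :=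
  forall i j : 'I_n, (i < j)%N -> x i 0 < x j 0.

End Vectors.

Definition is_argmin (A : Type) (R : realType) (F : A -> R) (a : A) : Prop :=
  forall b, F a <= F b.

Section WeakDerivatives.
Context {R : realType}.
Local Notation mu := (@lebesgue_measure R).

Definition test_function (phi : R -> R) : Prop :=
  (forall k x, derivable (derive1n k phi) x 1) /\
  exists S : set R, [/\ compact S, S `<=` `]0, 1[
    & forall x, ~ S x -> phi x = 0].

(* g is the k-th weak derivative of f on the open unit interval. *)
Definition weak_derivative (k : nat) (f g : R -> R) : Prop :=
  [/\ locally_integrable `]0, 1[ f, locally_integrable `]0, 1[ g
    & forall phi, test_function phi ->
      \int[mu]_(x in `]0, 1[) (f x * derive1n k phi x) =
      (-1) ^+ k * \int[mu]_(x in `]0, 1[) (g x * phi x)].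

End WeakDerivatives.

Section RandomVectors.
Context d (T : measurableType d) (R : realType) (P : probability T R).
Local Open Scope ereal_scope.

Definition mutually_independent n (X : 'I_n -> T -> R) : Prop :=
  forall (J : {set 'I_n}) (A : 'I_n -> set R), (forall i, measurable (A i)) ->
    P [set w | forall i, i \in J -> A i (X i w)] =
    \prod_(i in J) P (X i @^-1` A i).

(* Independence of the sigma-algebras generated by the two random vectors. *)
Definition independent_families n m (X : 'I_n -> T -> R) (Y : 'I_m -> T -> R)
    : Prop :=
  forall A B, g_sigma_preimage X A -> g_sigma_preimage Y B ->
    P (A `&` B) = P A * P B.

Definition identically_distributed n (X : 'I_n -> {RV P >-> R}) : Prop :=
  forall i j (A : set R), measurable A ->
    distribution P (X i) A = distribution P (X j) A.

Definition order_statistics n (U : 'I_n -> T -> R) (w : T) : 'cV[R]_n :=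
  \col_(i < n) nth 0%R (sort <=%R [seq U j w | j <- enum 'I_n]) i.

Definition subgaussian (K : R) (X : T -> R) : Prop :=
  forall t : R, mmt_gen_fun P X t <= (expR (K ^+ 2 * t ^+ 2 / 2)%R)%:E.

End RandomVectors.

(* Main.v *)
Require Import Defs.
From HB Require Import structures.
From mathcomp Require Import all_boot all_order all_algebra.
From mathcomp Require Import all_classical all_reals all_analysis.
From mathcomp Require Import measurable_realfun ring lra zify.
Import Order.TTheory GRing.Theory Num.Theory.
Import numFieldNormedType.Exports.
Set Implicit Arguments.
Unset Strict Implicit.
Unset Printing Implicit Defensive.
Local Open Scope classical_set_scope.
Local Open Scope ring_scope.

(** The criterion is quadratic, so for distinct design points the minimiser is
    [S (theta0 + eps)], where [theta0] is the vector of the values of [f0] and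
    [S] is the inverse of [1 + lam Q], with [Q] the matrix of the penalty.
    Its error is the sum of the bias [S theta0 - theta0] and of the noise
    [S eps] ([bw_risk_le]).

    Bias. It is at most [lam / 2] times the roughness of [theta0]
    ([bw_bias_le]), and this roughness is at most the integral of the square of
    the second derivative of [f0] ([bending_sample_le]). For a smooth function
    that is Jensen's inequality, a second divided difference being the mean of
    the second derivative against a hat function. For a weak derivative the hat
    functions are regularised into test functions, and continuity of [f0]
    removes the regularisation.

    Noise. Write [r] for [n ^ (1 / 5) * Cn ^ (2 / 5)]. Every design of distinct
    points inside the unit interval, however clustered, gives a smoother with
    squared Frobenius norm at most [26 * r] ([smoother_frobenius]). Indeed the
    squared norm of a column of [S] is at most the diagonal entry, which is the
    squared norm of evaluation at that point for the penalised quadratic form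
    ([smoother_frobenius_le]). Cut the interval into about [r] cells. Within a
    cell a vector differs from a line by an amount controlled by its roughness,
    by a discrete Sobolev inequality that ignores the spacing ([line_dev_le]);
    evaluating the line costs its leverage, and the leverages of a cell sum to
    at most 2 ([eval_norm_sum_le]). For a fixed matrix, independent sub-Gaussian
    errors then give an exponential tail for the squared norm at the scale of
    the squared Frobenius norm ([quadratic_tail]).

    Random design. The order statistics are almost surely distinct and interior
    ([regular_design_ae]). The smoother depends on the design only, which is
    independent of the errors, so the tail bound integrates over the design
    ([indep_section_le], [design_noise_tail]).

    Since [n = n ^ (1 / 5) ^ 5], the bias costs [3 * c * r] and the noise, off
    an event of probability [exp (- c2 * c)], at most [22 * c * r]; the
    normalised rate is [r / n]. *)

(** * A discrete Sobolev inequality *)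

Section DiscreteSobolev.
Variable R : realFieldType.

Lemma sqr_sum_weight_le (I : Type) (r : seq I) (Q : pred I) (a d : I -> R) :
  (forall i, Q i -> 0 <= d i) ->
  (\sum_(i <- r | Q i) a i * d i) ^+ 2 <=
    (\sum_(i <- r | Q i) a i ^+ 2 * d i) * \sum_(i <- r | Q i) d i.
Proof.
move=> d_ge0; set B := \sum_(i <- r | Q i) a i * d i.
set C := \sum_(i <- r | Q i) a i ^+ 2 * d i.
set D := \sum_(i <- r | Q i) d i.
(* Both cases below choose multipliers in this sum of squares; when the weights
   sum to 0 they are tuned to make it equal to -1 unless [B] vanishes. *)
have quad (s t : R) : 0 <= s ^+ 2 * C - 2 * s * t * B + t ^+ 2 * D.
  rewrite (_ : _ + _ = \sum_(i <- r | Q i) (s * a i - t) ^+ 2 * d i).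
    by apply: sumr_ge0 => i /d_ge0 ?; rewrite mulr_ge0 ?sqr_ge0.
  rewrite /B /C /D !mulr_sumr -sumrB -big_split /=.
  by apply: eq_bigr => i _; ring.
have D_ge0 : 0 <= D by apply: sumr_ge0.
have [D0|D_neq0] := eqVneq D 0.
  rewrite D0 mulr0; have [->|B_neq0] := eqVneq B 0; first by rewrite expr0n.
  have := quad 1 ((C + 1) / (2 * B)).
  have -> : 2 * 1 * ((C + 1) / (2 * B)) * B = C + 1 by field.
  rewrite D0; lra.
have := quad D B.
rewrite (_ : _ + _ = D * (C * D - B ^+ 2)); last by ring.
by rewrite pmulr_rge0 ?subr_ge0// lt0r D_neq0.
Qed.

Variables (x : nat -> R) (N : nat).
Hypothesis x_incr : forall k, (k.+1 < N)%N -> x k < x k.+1.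

Lemma knots_mono a b : (a <= b)%N -> (b < N)%N -> x a <= x b.
Proof.
elim: b => [|b IH]; first by rewrite leqn0 => /eqP->.
rewrite leq_eqVlt => /predU1P[->//|ab bN].
by apply: le_trans (IH _ _) _; rewrite ?ltW ?x_incr//; lia.
Qed.

Definition slope (th : nat -> R) k := (th k.+1 - th k) / (x k.+1 - x k).

Definition bending (th : nat -> R) :=
  \sum_(0 <= k < N - 2)
    2 * (slope th k.+1 - slope th k) ^+ 2 / (x k.+2 - x k).

Lemma x_gap2 k : (k < N - 2)%N -> x k < x k.+2.
Proof. by move=> kN; apply: (@lt_trans _ _ (x k.+1)); apply: x_incr; lia. Qed.

Lemma bending_ge0 th : 0 <= bending th.
Proof.
rewrite /bending big_nat_cond sumr_ge0// => k /andP[kN _].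
by rewrite divr_ge0 1?mulr_ge0 ?sqr_ge0// subr_ge0 ltW// x_gap2.
Qed.

Lemma bending_sub_le th p l : (p <= l)%N -> (l < N.-1)%N ->
  \sum_(p <= k < l) 2 * (slope th k.+1 - slope th k) ^+ 2 / (x k.+2 - x k)
    <= bending th.
Proof.
move=> pl lN.
have term_ge0 a b : (b <= N - 2)%N -> 0 <= \sum_(a <= k < b)
    2 * (slope th k.+1 - slope th k) ^+ 2 / (x k.+2 - x k).
  move=> bN; rewrite big_nat_cond; apply: sumr_ge0 => k /andP[/andP[_ kb] _].
  have xk : x k < x k.+2 by apply: x_gap2; lia.
  by rewrite divr_ge0 1?mulr_ge0 ?sqr_ge0// subr_ge0 ltW.
rewrite /bending [leRHS](@big_cat_nat _ _ _ p) //=; last lia.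
rewrite [X in _ <= _ + X](@big_cat_nat _ _ _ l)//=; last lia.
have := @term_ge0 0 p; have := @term_ge0 l (N - 2)%N.
move=> /(_ (leqnn _)) + /(_ ltac:(lia)); lra.
Qed.

(** Cauchy-Schwarz with the weights of the bending energy, which telescope: the
    gaps [x k.+2 - x k] cover each point at most twice, and the factor 1 / 2
    compensates. *)
Lemma slope_dev_le th p l : (p <= l)%N -> (l.+1 < N)%N ->
  (slope th l - slope th p) ^+ 2 <= (x l.+1 - x p) * bending th.
Proof.
move=> pl lN.
pose d k := (x k.+2 - x k) / 2.
have d_gt0 k : (k < N - 2)%N -> 0 < d k.
  by move=> /x_gap2; rewrite /d -subr_gt0 => ?; rewrite divr_gt0.
have -> : slope th l - slope th p =
    \sum_(p <= k < l) (slope th k.+1 - slope th k) / d k * d k.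
  rewrite -(telescope_sumr (slope th) pl); apply: eq_big_nat => k kl.
  by rewrite divfK// gt_eqF// d_gt0//; lia.
rewrite big_nat_cond.
apply: le_trans (sqr_sum_weight_le _ _ _) _ => [k /andP[kl _]|].
  by rewrite ltW// d_gt0//; lia.
rewrite -!big_nat_cond mulrC.
have pos k : (p <= k < l)%N -> 0 < x k.+2 - x k.
  by move=> kl; rewrite subr_gt0 x_gap2//; lia.
apply: ler_pM.
- rewrite big_nat_cond sumr_ge0// => k /andP[kl _].
  by rewrite divr_ge0 // ltW// pos.
- rewrite big_nat_cond sumr_ge0// => k /andP[kl _].
  by rewrite mulr_ge0 ?sqr_ge0// divr_ge0// ltW// pos.
- have -> : \sum_(p <= k < l) d k = (x l.+1 + x l - (x p.+1 + x p)) / 2.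
    rewrite -(telescope_sumr (fun k => x k.+1 + x k) pl) mulr_suml.
    by apply: eq_big_nat => k _; rewrite /d; congr (_ / _); ring.
  have := @knots_mono p p.+1; have := @knots_mono l l.+1.
  move=> /(_ ltac:(lia) ltac:(lia)) + /(_ ltac:(lia) ltac:(lia)); lra.
- apply: le_trans (bending_sub_le th pl _); last lia.
  rewrite le_eqVlt; apply/orP; left; apply/eqP; apply: eq_big_nat => k kl.
  by rewrite /d; field; rewrite gt_eqF// pos.
Qed.

(** Two integrations of the bound on the variation of the slope: the distance
    of [th j] to the line through the data at [p] and [p.+1] costs [h ^+ 3]
    times the bending energy, however the knots are spread. *)
Lemma line_dev_le th p j (h : R) : (p <= j)%N -> (j < N)%N -> x j - x p <= h ->
  (th j - th p - slope th p * (x j - x p)) ^+ 2 <= h ^+ 3 * bending th.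
Proof.
move=> pj jN xh.
have pos l : (p <= l < j)%N -> 0 < x l.+1 - x l.
  by move=> lj; rewrite subr_gt0 x_incr//; lia.
have -> : th j - th p - slope th p * (x j - x p) =
    \sum_(p <= l < j) (slope th l - slope th p) * (x l.+1 - x l).
  rewrite -(telescope_sumr x pj) -(telescope_sumr th pj) mulr_sumr -sumrB.
  apply: eq_big_nat => l lj; rewrite mulrBl /slope divfK//.
  by rewrite gt_eqF// pos.
have sumx : \sum_(p <= l < j) (x l.+1 - x l) = x j - x p.
  exact: telescope_sumr.
rewrite big_nat_cond.
apply: le_trans (sqr_sum_weight_le _ _ _) _ => [l /andP[lj _]|].
  by rewrite ltW// pos.
rewrite -!big_nat_cond sumx.
have xpj : 0 <= x j - x p by rewrite subr_ge0 knots_mono.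
have E_ge0 := bending_ge0 th.
apply: (@le_trans _ _ ((h * bending th * h) * h)); last first.
  by rewrite le_eqVlt; apply/orP; left; apply/eqP; ring.
have h_ge0 : 0 <= h by lra.
apply: ler_pM => //.
  rewrite big_nat_cond sumr_ge0// => k /andP[kl _].
  by rewrite mulr_ge0 ?sqr_ge0// ltW// pos.
apply: (@le_trans _ _ (\sum_(p <= l < j) h * bending th * (x l.+1 - x l))).
  apply: ler_sum_nat => l /[dup] lj /andP[pl lj'].
  apply: ler_wpM2r; first by rewrite ltW// pos.
  apply: le_trans (slope_dev_le _ _ _) _ => //; first by apply: leq_trans jN.
  rewrite ler_wpM2r//; by have := knots_mono lj' jN; lra.
by rewrite -mulr_sumr sumx ler_wpM2l// mulr_ge0.
Qed.

End DiscreteSobolev.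

(** * Leverage scores of a straight-line fit *)

Section Leverage.
Variables (R : realFieldType) (I : finType) (B : {set I}) (x : I -> R).

Definition block_mean : R := (\sum_(j in B) x j) / #|B|%:R.

Definition block_ss : R := \sum_(j in B) (x j - block_mean) ^+ 2.

Definition leverage i : R := #|B|%:R^-1 + (x i - block_mean) ^+ 2 / block_ss.

Lemma block_ss_ge0 : 0 <= block_ss.
Proof. by apply: sumr_ge0 => j _; apply: sqr_ge0. Qed.

Lemma leverage_ge0 i : 0 <= leverage i.
Proof.
by rewrite addr_ge0 ?invr_ge0 ?ler0n// divr_ge0 ?sqr_ge0 ?block_ss_ge0.
Qed.

(** The leverage of [i] is the squared norm of evaluation at [i] on affine
    functions of [x] with the Euclidean norm over [B]; centring at the mean
    makes the two coordinates of an affine function orthogonal. *)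
Lemma affine_sqr_le_leverage i (a b : R) : i \in B ->
  (a + b * x i) ^+ 2 <= leverage i * \sum_(j in B) (a + b * x j) ^+ 2.
Proof.
move=> iB.
have k_gt0 : 0 < #|B|%:R :> R by rewrite ltr0n (cardD1 i) iB.
set xb := block_mean; set k : R := #|B|%:R.
pose al := a + b * xb.
have center : \sum_(j in B) (x j - xb) = 0.
  rewrite sumrB sumr_const -mulr_natl /xb.
  by rewrite /block_mean mulrCA divff ?mulr1 ?subrr// gt_eqF.
have -> : \sum_(j in B) (a + b * x j) ^+ 2 = k * al ^+ 2 + b ^+ 2 * block_ss.
  rewrite (eq_bigr (fun j => al ^+ 2 + (2 * al * b * (x j - xb) +
      b ^+ 2 * (x j - xb) ^+ 2))); last by move=> j _; rewrite /al; ring.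
  rewrite big_split/= sumr_const big_split/= -!mulr_sumr center.
  by rewrite mulr0 add0r mulr_natl.
have -> : a + b * x i = al + b * (x i - xb) by rewrite /al; ring.
rewrite /leverage -/xb -/k.
have [SS0|SSn0] := eqVneq block_ss 0.
  have -> : x i - xb = 0.
    apply/eqP; rewrite -sqrf_eq0; move/eqP: SS0.
    rewrite psumr_eq0 => [/allP/(_ i)|j _]; last exact: sqr_ge0.
    by rewrite mem_index_enum iB => /(_ isT).
  rewrite SS0 expr0n/= mul0r !mulr0 !addr0 mulrA mulVf ?mul1r//.
  by rewrite gt_eqF.
have SS_gt0 : 0 < block_ss by rewrite lt0r SSn0 block_ss_ge0.
set e := x i - xb; set s := block_ss in SSn0 SS_gt0 *.
rewrite -subr_ge0.
rewrite (_ : _ - _ = k^-1 * s^-1 * (b * s - k * al * e) ^+ 2).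
  by rewrite mulr_ge0 ?sqr_ge0// mulr_ge0// invr_ge0 ltW.
by field; rewrite SSn0 gt_eqF.
Qed.

(** The trace of the projection onto the affine functions. *)
Lemma leverage_sum_le2 : \sum_(i in B) leverage i <= 2.
Proof.
rewrite big_split/= -mulr_suml -/block_ss sumr_const.
have divff_le1 (u : R) : u / u <= 1.
  by have [->|?] := eqVneq u 0; rewrite ?mul0r ?ler01// divff.
have := divff_le1 block_ss; have := divff_le1 #|B|%:R.
rewrite mulr_natl; lra.
Qed.

End Leverage.

(** * Evaluation at a design point *)

Section Evaluation.
Variables (R : realFieldType) (n m : nat) (blk : 'I_n -> 'I_m).
Variables (x : nat -> R) (lam h : R).
Hypothesis x_incr : forall k, (k.+1 < n)%N -> x k < x k.+1.
Hypothesis lam_gt0 : 0 < lam.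
Hypothesis h_ge0 : 0 <= h.
Hypothesis blk_small : forall i j : 'I_n, blk i = blk j -> x j - x i <= h.

Definition block_of i : {set 'I_n} := [set j | blk j == blk i]%SET.

Definition eval_norm i : R :=
  let lev := leverage (block_of i) (fun j : 'I_n => x j) i in
  4 * lev + (4 * #|block_of i|%:R * lev + 2) * (h ^+ 3 / lam).

Lemma eval_norm_ge0 i : 0 <= eval_norm i.
Proof.
rewrite /eval_norm; move: (leverage _ _ _) (leverage_ge0 (block_of i)
  (fun j : 'I_n => x j) i) => l l0.
have q0 : 0 <= h ^+ 3 / lam by rewrite divr_ge0 ?exprn_ge0// ltW.
move: (h ^+ 3 / lam) q0 => q q0.
by rewrite addr_ge0 ?(mulr_ge0, addr_ge0, ler0n).
Qed.

(** Within its block the vector is close to the line through its first two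
    entries, and a line is controlled at a point by the leverage. *)
Lemma eval_sqr_le (th : nat -> R) (i : 'I_n) :
  th i ^+ 2 <=
    eval_norm i * (\sum_(j < n) th j ^+ 2 + lam * bending x n th).
Proof.
set B := block_of i; set E := bending x n th.
have iB : i \in B by rewrite inE.
have [p pB p_min] := @arg_minnP _ i [in B] (fun j : 'I_n => j : nat) iB.
pose l (j : 'I_n) := (th p - slope x th p * x p) + slope x th p * x j.
have rem (j : 'I_n) : j \in B -> (th j - l j) ^+ 2 <= h ^+ 3 * E.
  move=> jB; rewrite (_ : _ - _ = th j - th p - slope x th p * (x j - x p)).
    apply: line_dev_le => //; first exact: p_min.
    apply: blk_small; move: pB jB; rewrite !inE => /eqP-> /eqP->//.
  by rewrite /l; ring.
have sqr2 (u v : R) : u ^+ 2 <= 2 * v ^+ 2 + 2 * (u - v) ^+ 2.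
  have := sqr_ge0 (u - v - v); nra.
have sumB : \sum_(j in B) th j ^+ 2 <= \sum_(j < n) th j ^+ 2.
  rewrite [leRHS](bigID [in B])/= lerDl sumr_ge0// => j _; exact: sqr_ge0.
set L := leverage B (fun j : 'I_n => x j) i.
have L_ge0 : 0 <= L by apply: leverage_ge0.
have l_le : l i ^+ 2 <= L * \sum_(j in B) l j ^+ 2.
  exact: affine_sqr_le_leverage.
have suml : \sum_(j in B) l j ^+ 2 <=
    2 * \sum_(j in B) th j ^+ 2 + #|B|%:R * (2 * (h ^+ 3 * E)).
  rewrite [#|B|%:R * _]mulr_natl -sumr_const mulr_sumr -big_split/=.
  apply: ler_sum => j jB; apply: le_trans (sqr2 _ (th j)) _.
  by rewrite lerD2l ler_wpM2l// -sqrrN opprB rem.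
have E_ge0 : 0 <= E by exact: bending_ge0.
have := rem i iB; have := sqr2 (th i) (l i).
rewrite /eval_norm -/B -/L.
set S := \sum_(j < n) _ in sumB *.
have S_ge0 : 0 <= S by apply: sumr_ge0 => j _; apply: sqr_ge0.
set q := h ^+ 3 / lam.
have qE : h ^+ 3 * E = q * (lam * E).
  by rewrite /q mulrA divfK// gt_eqF.
have q_ge0 : 0 <= q by rewrite divr_ge0 ?exprn_ge0// ltW.
set F := lam * E in qE *; have F_ge0 : 0 <= F by rewrite mulr_ge0// ltW.
rewrite qE in suml *.
set k : R := #|B|%:R in suml *.
have k_ge0 : 0 <= k by rewrite ler0n.
move=> h1 h2.
have h3 : l i ^+ 2 <= L * (2 * S + k * (2 * (q * F))).
  apply: le_trans l_le _; rewrite ler_wpM2l//; apply: le_trans suml _; lra.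
have t1 : 0 <= (4 * k * L + 2) * q * S.
  by rewrite mulr_ge0// mulr_ge0// addr_ge0// mulr_ge0// mulr_ge0.
have t2 : 0 <= L * F by rewrite mulr_ge0.
lra.
Qed.

(** The leverages of one block sum to at most the dimension 2 of the affine
    functions, so the total is governed by the number of blocks. *)
Lemma eval_norm_sum_le :
  \sum_(i < n) eval_norm i <=
    8 * m%:R + 10 * n%:R * (h ^+ 3 / lam).
Proof.
set q := h ^+ 3 / lam.
have q_ge0 : 0 <= q by rewrite divr_ge0 ?exprn_ge0// ltW.
have block_eq (i : 'I_n) c : blk i = c -> block_of i = [set j | blk j == c]%SET.
  by move=> <-.
rewrite (partition_big blk predT)//=.
have -> : 8 * m%:R + 10 * n%:R * q = \sum_(c < m)
    (8 + 10 * #|[set j | blk j == c]%SET|%:R * q).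
  rewrite big_split/= sumr_const card_ord mulr_natr.
  congr (_ + _); rewrite -mulr_suml -mulr_sumr -natr_sum.
  congr (_ * _%:R * _).
  rewrite -[LHS]card_ord -sum1_card (partition_big blk predT)//=.
  apply: eq_bigr => c _; rewrite -sum1_card; apply: eq_bigl => j.
  by rewrite inE.
apply: ler_sum => c _; set B := [set j | blk j == c]%SET.
pose L i := leverage B (fun j : 'I_n => x j) i.
have -> : \sum_(i < n | blk i == c) eval_norm i = \sum_(i in B)
    ((4 + 4 * #|B|%:R * q) * L i + 2 * q).
  apply: eq_big => [i|i /eqP ic]; first by rewrite inE.
  by rewrite /eval_norm (block_eq _ _ ic) -/(L i) -/q; ring.
rewrite big_split/= -mulr_sumr sumr_const -mulr_natl.
have k_ge0 : 0 <= #|B|%:R :> R by rewrite ler0n.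
have : (4 + 4 * #|B|%:R * q) * (\sum_(i in B) L i) <= (4 + 4 * #|B|%:R * q) * 2.
  by rewrite ler_wpM2l ?leverage_sum_le2// addr_ge0// mulr_ge0// mulr_ge0.
lra.
Qed.

End Evaluation.

(** * The filter as a linear smoother *)

Section Dot.
Variable R : realType.

Definition dot n (u v : 'cV[R]_n) : R := (u^T *m v) 0 0.

Lemma dotE n (u v : 'cV[R]_n) : dot u v = \sum_i u i 0 * v i 0.
Proof. by rewrite /dot mxE; apply: eq_bigr => i _; rewrite mxE. Qed.

Lemma sqnorm2_dot n (u : 'cV[R]_n) : sqnorm2 u = dot u u.
Proof. by rewrite dotE; apply: eq_bigr => i _; rewrite expr2. Qed.

Lemma sqnorm2_ge0 n (u : 'cV[R]_n) : 0 <= sqnorm2 u.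
Proof. by apply: sumr_ge0 => i _; exact: sqr_ge0. Qed.

Lemma sqnorm2_eq0 n (u : 'cV[R]_n) : sqnorm2 u <= 0 -> u = 0.
Proof.
move=> u0; apply/colP => i; rewrite mxE; apply/eqP; rewrite -sqrf_eq0.
have : \sum_(i < n) u i 0 ^+ 2 == 0 by rewrite eq_le u0 sqnorm2_ge0.
rewrite psumr_eq0 => [/allP/(_ i)|j _]; last exact: sqr_ge0.
by rewrite mem_index_enum => /(_ isT).
Qed.

Lemma dotC n (u v : 'cV[R]_n) : dot u v = dot v u.
Proof. by rewrite !dotE; apply: eq_bigr => i _; rewrite mulrC. Qed.

Lemma dotDr n (u v w : 'cV[R]_n) : dot u (v + w) = dot u v + dot u w.
Proof. by rewrite /dot mulmxDr mxE. Qed.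

Lemma dotBr n (u v w : 'cV[R]_n) : dot u (v - w) = dot u v - dot u w.
Proof. by rewrite /dot mulmxBr !mxE. Qed.

Lemma dotBl n (u v w : 'cV[R]_n) : dot (v - w) u = dot v u - dot w u.
Proof. by rewrite dotC dotBr !(dotC u). Qed.

Lemma dotZr n (a : R) (u v : 'cV[R]_n) : dot u (a *: v) = a * dot u v.
Proof. by rewrite /dot -scalemxAr mxE. Qed.

Lemma dot_mulmxr m n (A : 'M[R]_(m, n)) u v :
  dot u (A *m v) = dot (A^T *m u) v.
Proof. by rewrite /dot trmx_mul trmxK mulmxA. Qed.

Lemma sqnorm2D_le n (u v : 'cV[R]_n) :
  sqnorm2 (u + v) <= 2 * sqnorm2 u + 2 * sqnorm2 v.
Proof.
rewrite /sqnorm2 !mulr_sumr -big_split/=; apply: ler_sum => i _.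
by rewrite mxE; have := sqr_ge0 (u i 0 - v i 0); nra.
Qed.

End Dot.

Section Smoother.
Variables (R : realType) (n : nat).
Implicit Types (lam : R) (x y u v theta : 'cV[R]_n).
Local Notation elt v i k := (v (@offset _ k isT i) 0) (only parsing).

Definition diff2_mx x : 'M[R]_(n - 2, n) :=
  \matrix_(i, j)
    (2 / (elt x i 2 - elt x i 0) *
     (((j == @offset _ 2 isT i)%:R - (j == @offset _ 1 isT i)%:R) /
        (elt x i 2 - elt x i 1) -
      ((j == @offset _ 1 isT i)%:R - (j == @offset _ 0 isT i)%:R) /
        (elt x i 1 - elt x i 0))).

Definition diff2_weight x : 'rV[R]_(n - 2) :=
  \row_i ((elt x i 2 - elt x i 0) / 2).

Definition bw_mx lam x : 'M[R]_n :=
  1%:M + lam *: ((diff2_mx x)^T *m diag_mx (diff2_weight x) *m diff2_mx x).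

Definition bw_form x u v : R :=
  dot (diff2_mx x *m u) (diag_mx (diff2_weight x) *m (diff2_mx x *m v)).

Definition roughness x theta : R :=
  \sum_(i < n - 2)
    (discrete_deriv2 x theta i 0) ^+ 2 * ((elt x i 2 - elt x i 0) / 2).

Lemma diff2_mxE x theta : discrete_deriv2 x theta = diff2_mx x *m theta.
Proof.
apply/colP => i; rewrite !mxE.
have sel (k : 'I_n) : \sum_j (j == k)%:R * theta j 0 = theta k 0.
  rewrite (bigD1 k)//= eqxx mul1r big1 ?addr0// => j /negPf->.
  by rewrite mul0r.
set a := _ - _ : R; set b := elt x i 2 - _; set c := elt x i 1 - _.
under [RHS]eq_bigr => j _ do rewrite mxE -/a -/b -/c.
rewrite -!sel -!sumrB !mulr_suml -sumrB mulr_sumr.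
by apply: eq_bigr => j _; ring.
Qed.

Lemma bw_form_diag x theta : bw_form x theta theta = roughness x theta.
Proof.
rewrite /bw_form -diff2_mxE dotE; apply: eq_bigr => i _.
by rewrite mul_diag_mx !mxE; ring.
Qed.

Lemma bw_formC x u v : bw_form x u v = bw_form x v u.
Proof. by rewrite /bw_form dot_mulmxr tr_diag_mx dotC. Qed.

Lemma bw_formDr x u v w : bw_form x u (v + w) = bw_form x u v + bw_form x u w.
Proof. by rewrite /bw_form !mulmxDr dotDr. Qed.

Lemma roughnessD x u v :
  roughness x (u + v) = roughness x u + roughness x v + 2 * bw_form x u v.
Proof.
rewrite -!bw_form_diag bw_formDr (bw_formC x (u + v) u) (bw_formC x (u + v) v).
by rewrite !bw_formDr (bw_formC x v u); ring.
Qed.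

Lemma bw_mx_form lam x u v :
  dot u (bw_mx lam x *m v) = dot u v + lam * bw_form x u v.
Proof.
rewrite /bw_mx mulmxDl mul1mx dotDr -scalemxAl dotZr; congr (_ + _ * _).
by rewrite -!mulmxA dot_mulmxr trmxK.
Qed.

Lemma bw_mxC lam x u v : dot u (bw_mx lam x *m v) = dot v (bw_mx lam x *m u).
Proof. by rewrite !bw_mx_form dotC bw_formC. Qed.

Section Sorted.
Variables (lam : R) (x : 'cV[R]_n).
Hypothesis lam_ge0 : 0 <= lam.
Hypothesis x_sorted : forall i j : 'I_n, (i <= j)%N -> x i 0 <= x j 0.

Lemma roughness_ge0 theta : 0 <= roughness x theta.
Proof.
apply: sumr_ge0 => i _; rewrite mulr_ge0 ?sqr_ge0// divr_ge0// subr_ge0.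
by apply: x_sorted; rewrite leq_add2l.
Qed.

Lemma sqnorm2_le_bw theta : sqnorm2 theta <= dot theta (bw_mx lam x *m theta).
Proof.
by rewrite bw_mx_form bw_form_diag sqnorm2_dot lerDl mulr_ge0// roughness_ge0.
Qed.

Lemma bw_mx_unit : bw_mx lam x \in unitmx.
Proof.
rewrite unitmxE unitfE; apply/det0P => -[v v_neq0 vM0].
have : sqnorm2 v^T <= 0.
  apply: le_trans (sqnorm2_le_bw _) _.
  by rewrite /dot trmxK mulmxA vM0 mul0mx mxE.
by move=> /sqnorm2_eq0/(congr1 trmx); rewrite trmxK trmx0; apply/eqP.
Qed.

(** Completing the square. *)
Lemma bw_criterionE y theta :
  let best := invmx (bw_mx lam x) *m y in
  bw_criterion lam x y theta = bw_criterion lam x y best +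
    dot (theta - best) (bw_mx lam x *m (theta - best)).
Proof.
move=> best; have My : bw_mx lam x *m best = y by rewrite mulKVmx// bw_mx_unit.
have critE t : bw_criterion lam x y t =
    dot y y - 2 * dot t y + dot t (bw_mx lam x *m t).
  rewrite /bw_criterion -/(roughness x t) sqnorm2_dot bw_mx_form bw_form_diag.
  by rewrite !dotBl !dotBr (dotC y t); ring.
rewrite !critE mulmxBr !dotBl !dotBr My.
by rewrite (bw_mxC _ _ best theta) My; ring.
Qed.

Lemma argmin_bw y that :
  is_argmin (bw_criterion lam x y) that -> that = invmx (bw_mx lam x) *m y.
Proof.
set best := _ *m y => /(_ best); rewrite (bw_criterionE y that) -/best.
rewrite gerDl => le0; apply/subr0_eq/sqnorm2_eq0.
exact: le_trans (sqnorm2_le_bw _) le0.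
Qed.

(** The bias [b] satisfies [M b = - lam Q theta], so testing the equation
    against [b] bounds its size by the roughness of [theta] itself. *)
Lemma bw_bias_le theta :
  sqnorm2 (invmx (bw_mx lam x) *m theta - theta) <= lam / 2 * roughness x theta.
Proof.
set b := _ - theta.
have Mb : dot b (bw_mx lam x *m b) = - (lam * bw_form x b theta).
  rewrite {2}/b mulmxBr mulKVmx ?bw_mx_unit// dotBr bw_mx_form; ring.
move: Mb; rewrite bw_mx_form bw_form_diag -sqnorm2_dot => Mb.
have : 0 <= roughness x (b + theta) by exact: roughness_ge0.
have -> : roughness x (b + theta) =
    roughness x b + roughness x theta + 2 * bw_form x b theta.
  exact: roughnessD.
move=> E; have := roughness_ge0 b.
have : 0 <= lam * (roughness x b + roughness x theta + 2 * bw_form x b theta).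
  exact: mulr_ge0.
have := mulr_ge0 lam_ge0 (roughness_ge0 b); lra.
Qed.

Lemma bw_risk_le theta e that :
  is_argmin (bw_criterion lam x (theta + e)) that ->
  sqnorm2 (that - theta) <=
    lam * roughness x theta + 2 * sqnorm2 (invmx (bw_mx lam x) *m e).
Proof.
move=> /argmin_bw ->; rewrite mulmxDr addrAC.
apply: le_trans (sqnorm2D_le _ _) _; have := bw_bias_le theta; lra.
Qed.

(** The [i]-th column of the inverse is the representer of evaluation at [i],
    so its squared norm is at most the diagonal entry, which is the squared
    norm of that evaluation. *)
Lemma smoother_frobenius_le (kap : 'I_n -> R) : (forall i, 0 <= kap i) ->
  (forall theta i, theta i 0 ^+ 2 <=
     kap i * (sqnorm2 theta + lam * roughness x theta)) ->
  \sum_i \sum_j invmx (bw_mx lam x) j i ^+ 2 <= \sum_i kap i.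
Proof.
move=> kap_ge0 eval_le; apply: ler_sum => i _; set S := invmx _.
pose th : 'cV[R]_n := col i S.
have thE : dot th (bw_mx lam x *m th) = S i i.
  rewrite /th colE mulKVmx ?bw_mx_unit// dotE (bigD1 i)//= big1 => [|j ji].
    by rewrite -colE !mxE !eqxx mulr1 addr0.
  by rewrite !mxE (negPf ji) mulr0.
have -> : \sum_j S j i ^+ 2 = sqnorm2 th.
  by apply: eq_bigr => j _; rewrite mxE.
have := sqnorm2_le_bw th; rewrite thE => /le_trans; apply.
have := eval_le th i; rewrite -bw_form_diag sqnorm2_dot -bw_mx_form thE mxE.
have [->//|Sn0] := eqVneq (S i i) 0.
have S_ge0 : 0 <= S i i.
  by rewrite -thE; apply: le_trans (sqnorm2_le_bw _); exact: sqnorm2_ge0.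
by rewrite expr2 ler_pM2r// lt0r Sn0.
Qed.

End Sorted.

Definition nat_ext (v : 'cV[R]_n) (k : nat) : R :=
  if insub k is Some i then v i 0 else 0.

Lemma nat_extE v (i : 'I_n) : nat_ext v i = v i 0.
Proof. by rewrite /nat_ext valK. Qed.

Lemma roughness_bending x theta : strictly_increasing x ->
  roughness x theta = bending (nat_ext x) n (nat_ext theta).
Proof.
move=> x_incr; rewrite /bending big_mkord; apply: eq_bigr => i _.
rewrite /slope !mxE.
have e k (hk : (k <= 2)%N) v : nat_ext v (i + k) = v (offset hk i) 0.
  exact: (nat_extE v (offset hk i)).
have e0 := e 0%N isT; rewrite addn0 in e0.
have e1 := e 1%N isT; rewrite addn1 in e1.
have e2 := e 2%N isT; rewrite addn2 in e2.
rewrite !e0 !e1 !e2.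
have lt k l (hk : (k <= 2)%N) (hl : (l <= 2)%N) : (k < l)%N ->
    x (offset hk i) 0 < x (offset hl i) 0.
  by move=> kl; apply: x_incr; rewrite ltn_add2l.
have := lt 0%N 1%N isT isT isT; have := lt 1%N 2%N isT isT isT.
have := lt 0%N 2%N isT isT isT => ? ? ?; field.
by rewrite !subr_eq0 !gt_eqF.
Qed.

End Smoother.

(** * Smooth bumps *)

Section Smooth.
Variable R : realType.
Implicit Types (f g : R -> R) (p : {poly R}) (t x : R).

Lemma is_derive_near f g x d : (\near x, f x = g x) ->
  is_derive x 1 f d -> is_derive x 1 g d.
Proof.
move=> fg /is_derive1_caratheodory[q [fq qc qx]].
have fgx : f x = g x by exact: nbhs_singleton fg.
pose q' (z : R) : R := if z == x then d else (g z - g x) / (z - x).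
apply/is_derive1_caratheodory; exists q'; split.
- move=> z; rewrite /q'; case: eqP => [->|/eqP]; first by rewrite !subrr mulr0.
  by rewrite -subr_eq0 => /divfK->.
- have q'x : q' x = q x by rewrite /q' eqxx.
  suff : q' z @[z --> x] --> q x by rewrite -q'x.
  apply: cvg_trans qc.
  apply: near_eq_cvg; near=> z; rewrite /q'; case: eqP => [->//|/eqP zx].
  have <- : f z = g z by near: z.
  by rewrite -fgx fq mulfK// subr_eq0.
- by rewrite /q' eqxx.
Unshelve. all: by end_near. Qed.

(** The derivatives are carried as witnesses, so that products and affine
    substitutions are handled by induction on the order alone. *)
Fixpoint differentiable_n k f : Prop :=
  if k is k'.+1 then
    exists g, (forall x, is_derive x 1 f (g x)) /\ differentiable_n k' g
  else True.

Lemma differentiable_nW k f : differentiable_n k.+1 f -> differentiable_n k f.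
Proof.
elim: k f => [//|k IH] f [g [fg gk]]; exists g; split => //; exact: IH.
Qed.

Lemma differentiable_nD k f g : differentiable_n k f -> differentiable_n k g ->
  differentiable_n k (f \+ g).
Proof.
elim: k f g => [//|k IH] f g [f' [ff' f'k]] [g' [gg' g'k]].
by exists (f' \+ g'); split=> [x|]; [exact: is_deriveD|exact: IH].
Qed.

Lemma differentiable_nM k f g : differentiable_n k f -> differentiable_n k g ->
  differentiable_n k (f \* g).
Proof.
elim: k f g => [//|k IH] f g fk gk.
have [[f' [ff' f'k]] [g' [gg' g'k]]] := (fk, gk).
exists ((f \* g') \+ (f' \* g)); split=> [x|].
  apply: (is_derive_eq (is_deriveM (ff' x) (gg' x))).
  by rewrite /GRing.scale/= [g x * _]mulrC.
apply: differentiable_nD; apply: IH => //; exact: differentiable_nW.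
Qed.

Lemma differentiable_n_cst k (c : R) : differentiable_n k (cst c).
Proof.
elim: k c => [//|k IH] c; exists (cst 0); split => // x; exact: is_derive_cst.
Qed.

Lemma differentiable_n_sum k (I : Type) (r : seq I) (f : I -> R -> R) :
  (forall i, differentiable_n k (f i)) ->
  differentiable_n k (fun x => \sum_(i <- r) f i x).
Proof.
move=> fk; elim: r => [|i r IH].
  under eq_fun do rewrite big_nil; exact: differentiable_n_cst.
under eq_fun do rewrite big_cons; exact: differentiable_nD.
Qed.

Lemma is_derive_affine f d (a b x : R) : is_derive (a * x + b) 1 f d ->
  is_derive x 1 (fun t => f (a * t + b)) (d * a).
Proof.
move=> fd; apply: (@is_derive1_comp R f (fun t => a * t + b) x d a).
  apply: is_derive_eq.
  by rewrite addr0 /GRing.scale/= mulr1 ?mulr0 ?addr0.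
Qed.

Lemma differentiable_n_affine k f (a b : R) : differentiable_n k f ->
  differentiable_n k (fun t => f (a * t + b)).
Proof.
elim: k f => [//|k IH] f [g [fg gk]].
exists (fun t => g (a * t + b) * a); split=> [x|].
  exact: is_derive_affine.
apply: differentiable_nM (differentiable_n_cst _ _); exact: IH.
Qed.

Lemma derive1_funE f g : (forall x, is_derive x 1 f (g x)) -> derive1 f = g.
Proof. by move=> fg; apply/funext => x; rewrite derive1E; have [] := fg x. Qed.

Lemma derivable_derive1n f : (forall k, differentiable_n k f) ->
  forall k x, derivable (derive1n k f) x 1.
Proof.
move=> fs k; have := fs k.+1; elim: k f {fs} => [|k IH] f [g [fg gk]] x.
  by have [] := fg x.
by rewrite derive1Sn (derive1_funE fg); exact: IH.
Qed.

(** The derivatives of [exp (- 1 / t)], extended by 0, all have this shape, and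
    differentiating acts on the polynomial alone. *)
Definition flat p t : R := if 0 < t then p.[t^-1] * expR (- t^-1) else 0.

Lemma flat_le0 p t : t <= 0 -> flat p t = 0.
Proof. by rewrite /flat leNgt => /negPf->. Qed.

Lemma flatX p t : flat p t = flat ('X * p) t * t.
Proof.
rewrite /flat; case: ltP => [t0|]; last by rewrite mul0r.
by rewrite hornerM hornerX; field; rewrite gt_eqF.
Qed.

Lemma flat_le p : exists2 C : R, 0 <= C &
  forall t, `|t| <= 1 -> `|flat p t| <= C * `|t|.
Proof.
pose A := \sum_(i < size p) `|p`_i|; pose d := size p.
have A_ge0 : 0 <= A by apply: sumr_ge0.
exists (A * d.+1`!%:R) => [|t t1]; first by rewrite mulr_ge0.
rewrite /flat; case: ltP => [t0|_]; last by rewrite normr0 !mulr_ge0.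
rewrite (gtr0_norm t0) in t1 *; set s := t^-1.
have s1 : 1 <= s by rewrite invf_ge1.
have s0 : 0 < s by rewrite invr_gt0.
rewrite normrM (gtr0_norm (expR_gt0 _)) expRN -/s.
rewrite ler_pdivrMr ?expR_gt0//.
have ps : `|p.[s]| <= A * s ^+ d.
  rewrite horner_coef; apply: le_trans (ler_norm_sum _ _ _) _.
  rewrite mulr_suml; apply: ler_sum => i _; rewrite normrM ler_wpM2l//.
  by rewrite normrX (gtr0_norm s0) ler_weXn2l// ltnW.
apply: le_trans ps _; rewrite -!mulrA ler_wpM2l//.
have := @expR_ge1Dxn R s d (ltW s0).
have F0 : 0 < (d.+1)`!%:R :> R by rewrite ltr0n fact_gt0.
move=> H; have : s ^+ d.+1 / (d.+1)`!%:R <= expR s by lra.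
rewrite ler_pdivrMr// exprS => H1.
rewrite -(ler_pM2l s0); apply: le_trans H1 _.
rewrite [leRHS](_ : _ = (s * t) * ((d.+1)`!%:R * expR s)); last by ring.
by rewrite /s mulVf ?gt_eqF// mul1r mulrC.
Qed.

Lemma is_derive_flat p t :
  is_derive t 1 (flat p) (flat ('X ^+ 2 * (p - p^`())) t).
Proof.
have [t0|t0|->] := ltgtP t 0.
- rewrite flat_le0 ?ltW//; apply: is_derive_near (is_derive_cst 0 t 1).
  near=> u; rewrite flat_le0// ltW//; near: u; exact: lt_nbhsl.
- apply: (@is_derive_near (fun t => p.[t^-1] * expR (- t^-1))).
    near=> u; rewrite /flat ifT//; near: u; exact: lt_nbhsr.
  have dV : is_derive t 1 (fun t => t^-1) (- t ^- 2).
    apply: (is_derive_eq (is_deriveV _ (is_derive_id t 1))).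
      by rewrite gt_eqF.
    by rewrite /GRing.scale/= mulr1.
  have dp : is_derive t 1 (fun t => p.[t^-1]) (p^`().[t^-1] * - t ^- 2).
    exact: (@is_derive1_comp R (horner p) (fun t => t^-1)).
  have de : is_derive t 1 (fun t => expR (- t^-1)) (expR (- t^-1) * t ^- 2).
    apply: (@is_derive1_comp R expR (fun t => - t^-1)).
    by apply: is_derive_eq; rewrite opprK.
  apply: (is_derive_eq (is_deriveM dp de)).
  rewrite /flat t0 /GRing.scale/= hornerM hornerXn hornerD hornerN; field.
  by rewrite gt_eqF.
- rewrite flat_le0// -[X in is_derive _ _ _ X](@flat_le0 ('X * p) 0)//.
  apply/is_derive1_caratheodory; exists (flat ('X * p)); split => //.
    by move=> y; rewrite [flat p 0]flat_le0// !subr0 -flatX.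
  have [C C0 flatC] := flat_le ('X * p).
  suff : flat ('X * p) z @[z --> 0] --> 0 by rewrite -{2}(@flat_le0 ('X * p) 0).
  apply/cvgrPdist_le => e e0; near=> y; rewrite sub0r normrN.
  have y1 : `|y| <= 1.
    by near: y; exact: (@nbhs0_le R R^o 1 ltr01).
  apply: le_trans (flatC _ y1) _.
  have ye : `|y| <= e / (C + 1).
    by near: y; apply: (@nbhs0_le R R^o); rewrite divr_gt0//; lra.
  rewrite ler_pdivlMr in ye; last by lra.
  have := normr_ge0 y; nra.
Unshelve. all: by end_near. Qed.

Lemma differentiable_n_flat k p : differentiable_n k (flat p).
Proof.
elim: k p => [//|k IH] p; exists (flat ('X ^+ 2 * (p - p^`()))).
by split=> // x; exact: is_derive_flat.
Qed.

End Smooth.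

Section Ramp.
Variable R : realType.
Implicit Types (f g F : R -> R) (x : R).
Local Notation mu := (@lebesgue_measure R).

Lemma is_derive_continuous f g :
  (forall x, is_derive x 1 f (g x)) -> continuous f.
Proof.
move=> fg x; apply/differentiable_continuous/derivable1_diffP.
by have [] := fg x.
Qed.

Lemma is_derive_mvt f g (a b : R) : (forall x, is_derive x 1 f (g x)) ->
  a <= b -> exists2 c, a <= c <= b & f b - f a = g c * (b - a).
Proof.
move=> fg ab; have [|c + ->] := MVT_segment ab (fun x _ => fg x).
  exact/continuous_subspaceT/(is_derive_continuous fg).
by rewrite in_itv/= => cab; exists c.
Qed.

Lemma antiderivative_vanishing f : continuous f ->
  (forall x, x <= 0 -> f x = 0) ->
  exists F, (forall x, is_derive x 1 F (f x)) /\ (forall x, x <= 0 -> F x = 0).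
Proof.
move=> fc f0; pose F y := (\int[mu]_(t in `[-1, y]) f t)%R.
have F0 y : y <= 0 -> F y = 0.
  move=> y0; rewrite /F (@eq_Rintegral _ _ _ _ _ (cst 0)).
    by rewrite /Rintegral integral0.
  move=> t; rewrite inE/= in_itv/= => /andP[_ ty].
  by rewrite f0// (le_trans ty).
exists F; split => // x.
(* The base point -1 keeps the point 0 interior to the range of integration. *)
have [x0|x0] := leP 0 x; last first.
  rewrite f0 ?ltW//; apply: (@is_derive_near _ (cst 0)) (is_derive_cst 0 x 1).
  near=> y; rewrite F0// ltW//; near: y; exact: lt_nbhsl.
have [||||dF FE] := @continuous_FTC1_closed R f (-1) x (x + 1).
- by rewrite ltrDl.
- apply: continuous_compact_integrable; first exact: segment_compact.
  exact: continuous_subspaceT.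
- lra.
- exact: fc.
- by apply: DeriveDef => //; rewrite -derive1E.
Unshelve. all: by end_near. Qed.

(** A C-infinity regularisation of the hinge [t |-> max t 0], with its two
    derivatives and an antiderivative. *)
Record ramp (h : R) := Ramp {
  bump : R -> R;
  step : R -> R;
  hinge : R -> R;
  parabola : R -> R;
  bump_smooth : forall k, differentiable_n k bump;
  bump_ge0 : forall x, 0 <= bump x;
  bump_out : forall x, (x <= 0) || (h <= x) -> bump x = 0;
  is_derive_step : forall x, is_derive x 1 step (bump x);
  is_derive_hinge : forall x, is_derive x 1 hinge (step x);
  is_derive_parabola : forall x, is_derive x 1 parabola (hinge x);
  step_left : forall x, x <= 0 -> step x = 0;
  hinge_left : forall x, x <= 0 -> hinge x = 0;
  parabola_left : forall x, x <= 0 -> parabola x = 0;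
  step_right : forall x, h <= x -> step x = 1 }.

(** The product of two flat functions is a smooth bump; dividing by its total
    mass and integrating three times gives the rest. *)
Lemma ramp_exists (h : R) : 0 < h -> inhabited (ramp h).
Proof.
move=> h0; pose e t := flat 1 t * flat 1 (- 1 * t + h).
have es k : differentiable_n k e.
  apply: differentiable_nM; first exact: differentiable_n_flat.
  by apply: differentiable_n_affine; exact: differentiable_n_flat.
have flat_ge0 t : 0 <= flat 1 t :> R.
  by rewrite /flat hornerC; case: ifP => // _; rewrite mul1r expR_ge0.
have flat_gt0 t : 0 < t -> 0 < flat 1 t :> R.
  by move=> t0; rewrite /flat t0 hornerC mul1r expR_gt0.
have e_out x : (x <= 0) || (h <= x) -> e x = 0.
  case/orP => hx; first by rewrite /e flat_le0// mul0r.
  by rewrite /e [X in _ * X]flat_le0 ?mulr0//; lra.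
have cont f : (forall k, differentiable_n k f) -> continuous f.
  by move=> /(_ 1%N)[g [fg _]]; exact: is_derive_continuous fg.
have e0 x : x <= 0 -> e x = 0 by move=> x0; rewrite e_out// x0.
have [S [dS S0]] := antiderivative_vanishing (cont _ es) e0.
have e_ge0 x : 0 <= e x by rewrite mulr_ge0.
have S_mono a b : a <= b -> S a <= S b.
  move=> ab; have [c _ E] := is_derive_mvt dS ab.
  by rewrite -subr_ge0 E mulr_ge0// subr_ge0.
have S_right x : h <= x -> S x = S h.
  move=> hx; have [c /andP[hc _] E] := is_derive_mvt dS hx.
  by apply/subr0_eq; rewrite E e_out ?mul0r// hc orbT.
(* Without mass, the primitive would be constant near the midpoint, where its
   derivative, the bump, is positive. *)
have Sh : 0 < S h.
  have h02 : 0 < h / 2 by rewrite divr_gt0.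
  rewrite lt0r -{2}(S0 0)// S_mono ?ltW// andbT; apply/eqP => Sh0.
  have : \forall y \near (h / 2), cst 0 y = S y.
    near=> y.
    have y0 : 0 <= y by rewrite ltW//; near: y; apply: lt_nbhsr.
    have yh : y <= h by rewrite ltW//; near: y; apply: lt_nbhsl; lra.
    have := S_mono _ _ y0; have := S_mono _ _ yh.
    rewrite Sh0 (S0 0)// => Sy0 Sy1.
    by apply/eqP; rewrite eq_le Sy0 Sy1.
  move=> /(@is_derive_near _ _ _ _ (0 : R))-/(_ (is_derive_cst 0 _ _)).
  move=> [_ S'0]; have [_ S'e] := dS (h / 2); move: S'e; rewrite S'0.
  by apply/eqP; rewrite lt_eqF// mulr_gt0// flat_gt0//; lra.
pose B x := (S h)^-1 * e x; pose T x := (S h)^-1 * S x.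
have Bs k : differentiable_n k B.
  exact: differentiable_nM (differentiable_n_cst _ _) (es k).
have dT x : is_derive x 1 T (B x).
  apply: (is_derive_eq (is_deriveM (is_derive_cst (S h)^-1 x 1) (dS x))).
  by rewrite scaler0 addr0.
have T0 x : x <= 0 -> T x = 0 by move=> x0; rewrite /T (S0 x)// mulr0.
have [P [dP P0]] := antiderivative_vanishing (is_derive_continuous dT) T0.
have [Q [dQ Q0]] := antiderivative_vanishing (is_derive_continuous dP) P0.
constructor; apply: (@Ramp h B T P Q) => //.
- by move=> x; rewrite mulr_ge0// invr_ge0 ltW.
- by move=> x /e_out; rewrite /B => ->; rewrite mulr0.
- by move=> x hx; rewrite /T S_right// mulVf// gt_eqF.
Unshelve. all: by end_near. Qed.

Section RampTheory.
Variables (h : R) (r : ramp h).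

Lemma step_mono : {homo step r : a b / a <= b}.
Proof.
move=> a b ab; have [c _ E] := is_derive_mvt (is_derive_step r) ab.
by rewrite -subr_ge0 E mulr_ge0 ?bump_ge0// subr_ge0.
Qed.

Lemma step_ge0 x : 0 <= step r x.
Proof.
have [x0|/ltW x0] := leP x 0; first by rewrite step_left.
by rewrite -(step_left r (lexx 0)) step_mono.
Qed.

Lemma step_le1 x : step r x <= 1.
Proof.
have [xh|/ltW hx] := leP x h; last by rewrite step_right.
by rewrite -(step_right r (lexx h)) step_mono.
Qed.

Lemma hinge_right x : h <= x -> hinge r x = hinge r h + (x - h).
Proof.
move=> hx; have [c /andP[hc _] E] := is_derive_mvt (is_derive_hinge r) hx.
by rewrite (step_right r hc) mul1r in E; rewrite -E; ring.
Qed.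

End RampTheory.

Lemma convex_slope_le (g g1 : R -> R) (a b c : R) :
  (forall x, is_derive x 1 g (g1 x)) -> {homo g1 : u v / u <= v} ->
  a < b -> b < c -> (g b - g a) / (b - a) <= (g c - g b) / (c - b).
Proof.
move=> gg1 mono ab bc.
have [u /andP[_ ub] ->] := is_derive_mvt gg1 (ltW ab).
have [v /andP[bv _] ->] := is_derive_mvt gg1 (ltW bc).
by rewrite !mulfK ?mono ?(le_trans ub)// subr_eq0 gt_eqF.
Qed.

End Ramp.

(** * Roughness of a sampled function *)

Section SlopeCombination.
Variable R : realFieldType.
Variables (x : nat -> R) (N : nat) (v : nat -> R).

(** A linear functional of the data that ignores affine data. Expressed as a sum
    over the knots by [slope_combE], it commutes with integration and
    differentiation of data that depend on a parameter. *)
Definition slope_comb (th : nat -> R) : R :=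
  \sum_(0 <= k < N - 2) v k * (slope x th k.+1 - slope x th k).

Definition knot_weight (j : nat) : R := slope_comb (fun i => (i == j)%:R).

Lemma slope_sum th k : (k.+1 < N)%N ->
  slope x th k = \sum_(j < N) th j * slope x (fun i => (i == j)%:R) k.
Proof.
move=> kN; have sel i : (i < N)%N -> th i = \sum_(j < N) th j * (i == j)%:R.
  move=> iN; rewrite (bigD1 (Ordinal iN))//= eqxx mulr1 big1 ?addr0// => j ji.
  by rewrite eq_sym; move: ji; rewrite -val_eqE/= => /negPf->; rewrite mulr0.
rewrite {1}/slope [th k.+1]sel// [th k]sel; last lia.
rewrite -sumrB mulr_suml; apply: eq_bigr => j _; rewrite /slope; ring.
Qed.

Lemma slope_combE th : slope_comb th = \sum_(j < N) knot_weight j * th j.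
Proof.
rewrite /knot_weight /slope_comb.
under [RHS]eq_bigr => j _ do rewrite mulr_suml.
rewrite exchange_big/=; apply: eq_big_nat => k kN.
rewrite (slope_sum th (k := k.+1)); last lia.
rewrite (slope_sum th (k := k)); last lia.
by rewrite -sumrB mulr_sumr; apply: eq_bigr => j _; ring.
Qed.

Lemma slope_combB th th' :
  slope_comb (fun j => th j - th' j) = slope_comb th - slope_comb th'.
Proof. by rewrite !slope_combE -sumrB; apply: eq_bigr => j _; ring. Qed.

Lemma slope_comb_norm_le th e : (forall j, (j < N)%N -> `|th j| <= e) ->
  `|slope_comb th| <= (\sum_(j < N) `|knot_weight j|) * e.
Proof.
move=> the; rewrite slope_combE mulr_suml.
apply: le_trans (ler_norm_sum _ _ _) _; apply: ler_sum => j _.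
by rewrite normrM ler_wpM2l// the.
Qed.

Lemma slope_comb_affine (a b : R) :
  (forall k, (k.+1 < N)%N -> x k < x k.+1) ->
  slope_comb (fun j => a + b * x j) = 0.
Proof.
move=> x_incr; rewrite /slope_comb big_nat_cond big1// => k /andP[kN _].
have xk : x k < x k.+1 by apply: x_incr; lia.
have xk1 : x k.+1 < x k.+2 by apply: x_incr; lia.
by rewrite /slope; field; rewrite !subr_eq0 !gt_eqF.
Qed.

End SlopeCombination.

Lemma integrable_EFinD d (T : measurableType d) (R : realType)
    (mu : {measure set T -> \bar R}) (D : set T) (f g : T -> R) :
  measurable D -> mu.-integrable D (EFin \o f) ->
  mu.-integrable D (EFin \o g) ->
  mu.-integrable D (EFin \o (fun t => f t + g t)).
Proof. by move=> mD fi gi; exact: (integrableD mD fi gi). Qed.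

Lemma integrable_EFinZ d (T : measurableType d) (R : realType)
    (mu : {measure set T -> \bar R}) (D : set T) (c : R) (f : T -> R) :
  measurable D -> mu.-integrable D (EFin \o f) ->
  mu.-integrable D (EFin \o (fun t => c * f t)).
Proof. by move=> mD fi; exact: (integrableZl mD c fi). Qed.

Lemma Rintegral_combination d (T : measurableType d) (R : realType)
    (mu : {measure set T -> \bar R}) (I : Type) (r : seq I) (w : I -> R)
    (F : I -> T -> R) (D : set T) : measurable D ->
  (forall i, mu.-integrable D (EFin \o F i)) ->
  mu.-integrable D (EFin \o (fun t => \sum_(i <- r) w i * F i t)) /\
  (\int[mu]_(t in D) (\sum_(i <- r) w i * F i t) =
   \sum_(i <- r) w i * \int[mu]_(t in D) F i t)%R.
Proof.
move=> mD Fi; elim: r => [|i r [IH1 IH2]].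
  split; last first.
    rewrite big_nil; under eq_Rintegral do rewrite big_nil.
    by rewrite /Rintegral integral0.
  rewrite (_ : _ \o _ = cst 0%E); first exact: integrable0.
  by apply/funext => t /=; rewrite big_nil.
have wF : mu.-integrable D (EFin \o (fun t => w i * F i t)).
  exact: integrable_EFinZ.
split; last first.
  rewrite big_cons; under eq_Rintegral do rewrite big_cons.
  by rewrite RintegralD// IH2 RintegralZl.
have := integrable_EFinD mD wF IH1; congr (mu.-integrable _ _).
by apply/funext => t /=; rewrite big_cons.
Qed.

Section RampSums.
Variable R : realType.
Local Notation mu := (@lebesgue_measure R).

Lemma is_derive_bigsum (I : Type) (r : seq I) (F : I -> R -> R) (d : I -> R)
    (t : R) :
  (forall i, is_derive t 1 (F i) (d i)) ->
  is_derive t 1 (fun u => \sum_(i <- r) F i u) (\sum_(i <- r) d i).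
Proof.
move=> Fd; elim: r => [|i r IH].
  rewrite big_nil; under eq_fun do rewrite big_nil; exact: is_derive_cst.
by rewrite big_cons; under eq_fun do rewrite big_cons; exact: is_deriveD.
Qed.

Lemma is_derive_translate (F : R -> R) (d p t : R) :
  is_derive (t - p) 1 F d -> is_derive t 1 (fun u => F (u - p)) d.
Proof.
move=> Fd; have -> : (fun u => F (u - p)) = (fun u => F (1 * u + - p)).
  by apply/funext => u; rewrite mul1r.
by rewrite -[d]mulr1; apply: is_derive_affine; rewrite mul1r.
Qed.

Lemma is_derive_translates (I : Type) (r : seq I) (w p : I -> R)
    (F G : R -> R) :
  (forall t : R, is_derive t 1 F (G t)) -> forall t : R,
  is_derive t 1 (fun u => \sum_(i <- r) w i * F (u - p i))
                (\sum_(i <- r) w i * G (t - p i)).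
Proof.
move=> FG t; apply: is_derive_bigsum => i.
have FGi : is_derive t 1 (fun u => F (u - p i)) (G (t - p i)).
  exact: is_derive_translate (FG _).
apply: (is_derive_eq (is_deriveM (is_derive_cst (w i) t 1) FGi)).
by rewrite scaler0 addr0.
Qed.

Lemma integrable_within (f : R -> R) : {within `[0, 1], continuous f} ->
  mu.-integrable `]0, 1[ (EFin \o f).
Proof.
move=> fc.
have : mu.-integrable `[0, 1] (EFin \o f).
  by apply: continuous_compact_integrable => //; exact: segment_compact.
by apply: integrableS => //; exact: subset_itv_oo_cc.
Qed.

Lemma integrable_continuous (f : R -> R) : continuous f ->
  mu.-integrable `]0, 1[ (EFin \o f).
Proof. by move=> fc; apply: integrable_within; exact: continuous_subspaceT. Qed.

Lemma Rintegral_translate (G g : R -> R) (p : R) :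
  (forall t : R, is_derive t 1 G (g t)) -> continuous g -> 0 <= p ->
  (forall t, t <= 0 -> G t = 0) ->
  (\int[mu]_(t in `]0, 1[) g (t - p) = G (1 - p))%R.
Proof.
move=> Gg gc p0 G0.
have gpc : continuous (fun t => g (t - p)).
  move=> t; apply: (@continuous_comp _ _ _ (fun t => t - p) g); last exact: gc.
  by apply: cvgB; [exact: cvg_id|exact: cvg_cst].
have Gp (t : R) : is_derive t 1 (fun t => G (t - p)) (g (t - p)).
  exact: is_derive_translate (Gg _).
rewrite /Rintegral -(@integral_itv_bndoo R 0 1 _ true false); last first.
  have /integrableP[+ _] := integrable_continuous gpc; exact.
rewrite (@continuous_FTC2 R _ (fun t => G (t - p)))//.
- by rewrite [in X in (_ - X)%E]G0 ?sube0//; lra.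
- exact: continuous_subspaceT.
- have Gpc := is_derive_continuous Gp; split.
  + by move=> t _; have [] := Gp t.
  + by apply: cvg_at_right_filter; exact: Gpc.
  + by apply: cvg_at_left_filter; exact: Gpc.
- by move=> t _; rewrite derive1E; have [] := Gp t.
Qed.

End RampSums.

Section RampTest.
Variable R : realType.
Local Notation mu := (@lebesgue_measure R).
Variables (x : nat -> R) (N : nat).
Hypothesis x_incr : forall k, (k.+1 < N)%N -> x k < x k.+1.
Hypothesis x_in : forall k, (k < N)%N -> 0 < x k < 1.

Variables (h : R) (r : ramp h).
Hypothesis h_small : forall k, (k < N)%N -> x k + h < 1.

(** The difference of consecutive slopes of these data at [k] is, as a function
    of [t], a regularisation of the hat function of height 1 with knots [x k],
    [x k.+1] and [x k.+2]. *)
Definition hinge_at t (j : nat) : R := hinge r (t - x j).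

Lemma hinge_at_bend_ge0 t k : (k < N - 2)%N ->
  0 <= slope x (hinge_at t) k.+1 - slope x (hinge_at t) k.
Proof.
move=> kN; rewrite subr_ge0 /slope.
pose g p := hinge r (t - p); pose g1 p := - step r (t - p).
have gg1 (p : R) : is_derive p 1 g (g1 p).
  have -> : g = fun p => hinge r (-1 * p + t).
    by apply/funext => q; rewrite /g addrC mulN1r.
  rewrite (_ : g1 p = step r (-1 * p + t) * -1); last first.
    by rewrite /g1 mulrN1 mulN1r addrC.
  by apply: is_derive_affine; exact: is_derive_hinge.
have mono : {homo g1 : u v / u <= v}.
  by move=> u v uv; rewrite lerN2 step_mono// lerD2l lerN2.
apply: (convex_slope_le gg1 mono); apply: x_incr; lia.
Qed.

Lemma hinge_at_slope t k : (k.+1 < N)%N -> -1 <= slope x (hinge_at t) k <= 0.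
Proof.
move=> kN; have xk := x_incr kN; rewrite /slope /hinge_at.
have le : t - x k.+1 <= t - x k by lra.
have [c _ E] := is_derive_mvt (is_derive_hinge r) le.
have -> : hinge r (t - x k.+1) - hinge r (t - x k) =
    - step r c * (x k.+1 - x k).
  by apply: oppr_inj; rewrite opprB E; ring.
rewrite mulfK ?subr_eq0 ?gt_eqF//.
by rewrite lerN2 step_le1 oppr_le0 step_ge0.
Qed.

(** The hat functions form a partition of unity away from the ends; telescoping
    gives the bound everywhere. *)
Lemma hinge_at_bend_sum t : (2 < N)%N ->
  \sum_(0 <= k < N - 2) (slope x (hinge_at t) k.+1 - slope x (hinge_at t) k)
    <= 1.
Proof.
move=> N2; rewrite telescope_sumr//.
have /andP[_ +] := @hinge_at_slope t (N - 2)%N ltac:(lia).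
have /andP[+ _] := @hinge_at_slope t 0%N ltac:(lia); lra.
Qed.

Variable v : nat -> R.

Definition ramp_test t : R := slope_comb x N v (hinge_at t).

Lemma ramp_testE t :
  ramp_test t = \sum_(j < N) knot_weight x N v j * hinge r (t - x j).
Proof. exact: slope_combE. Qed.

Lemma derive2_ramp_test : derive1n 2 ramp_test =
  fun t => slope_comb x N v (fun j => bump r (t - x j)).
Proof.
pose w := knot_weight x N v.
rewrite derive1nS derive1n1.
have -> : ramp_test = fun t => \sum_(j < N) w j * hinge r (t - x j).
  by apply/funext => t; exact: ramp_testE.
rewrite (derive1_funE (is_derive_translates _ _ _ (is_derive_hinge r))).
rewrite (derive1_funE (is_derive_translates _ _ _ (is_derive_step r))).
by apply/funext => t; rewrite slope_combE.
Qed.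

(** The support is compact: left of the knots every hinge vanishes, and right of
    them the hinges are affine in the knot, which [slope_comb] ignores. *)
Lemma test_function_ramp_test : (0 < N)%N -> test_function ramp_test.
Proof.
move=> N0; split.
  apply: derivable_derive1n => k.
  have hs : differentiable_n k (hinge r).
    do 2![apply: differentiable_nW]; exists (step r); split.
      exact: is_derive_hinge.
    by exists (bump r); split; [exact: is_derive_step|exact: bump_smooth].
  rewrite (_ : ramp_test = fun t => \sum_(j <- index_enum 'I_N)
      knot_weight x N v j * hinge r (1 * t + - x j)); last first.
    apply/funext => t; rewrite ramp_testE.
    by under [RHS]eq_bigr do rewrite mul1r.
  apply: differentiable_n_sum => j.
  apply: (differentiable_nM (differentiable_n_cst k _)).
  exact: differentiable_n_affine.
exists `[x 0%N, x N.-1 + h]%classic; split.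
- exact: segment_compact.
- move=> t /=; rewrite !in_itv/= => /andP[t0 t1].
  have /andP[x0 _] := x_in N0; have := @h_small N.-1.
  rewrite prednK// => /(_ (leqnn _)) ?; lra.
- move=> t /=; rewrite in_itv/= => /negP; rewrite negb_and -!ltNge.
  move=> /orP[tx|xt].
    rewrite ramp_testE big1// => j _; rewrite hinge_left ?mulr0//.
    have := knots_mono x_incr (leq0n j) (ltn_ord j); lra.
  rewrite -(@slope_comb_affine R x N v (hinge r h + (t - h)) (-1))//.
  rewrite /ramp_test !slope_combE; apply: eq_bigr => j _; congr (_ * _).
  rewrite /hinge_at hinge_right; first ring.
  have jN : (j <= N.-1)%N by have := ltn_ord j; lia.
  have := knots_mono x_incr jN; rewrite prednK// => /(_ (leqnn _)); lra.
Qed.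

Lemma Rintegral_bump (j : 'I_N) :
  (\int[mu]_(t in `]0, 1[) bump r (t - x j) = 1)%R.
Proof.
have /andP[x0 x1] := x_in (ltn_ord j).
rewrite (Rintegral_translate (is_derive_step r)).
- by rewrite step_right//; have := h_small (ltn_ord j); lra.
- by have [g [bg _]] := bump_smooth r 1; exact: is_derive_continuous bg.
- exact: ltW.
- by move=> t; exact: step_left.
Qed.

Lemma hinge_integral_bend_le k : (k < N - 2)%N ->
  forall I : nat -> R,
  (forall j, I j = (\int[mu]_(t in `]0, 1[) hinge_at t j)%R) ->
  slope x I k.+1 - slope x I k <= (x k.+2 - x k) / 2.
Proof.
move=> kN I I_def.
have IE j : (j < N)%N -> I j = parabola r (1 - x j).
  move=> jN; rewrite I_def /hinge_at.
  rewrite (Rintegral_translate (is_derive_parabola r))//.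
  - exact: is_derive_continuous (is_derive_hinge r).
  - by have /andP[/ltW] := x_in jN.
  - by move=> t; exact: parabola_left.
have x0 : x k < x k.+1 by apply: x_incr; lia.
have x1 : x k.+1 < x k.+2 by apply: x_incr; lia.
rewrite /slope !IE; [|lia..].
(* The parabola minus its regularisation is convex, since the step is at most
   1, and the divided second difference of the parabola is exact. *)
pose g p := 2^-1 * (p * p) - parabola r (1 - p).
pose g1 p := p + hinge r (1 - p).
have gg1 (p : R) : is_derive p 1 g (g1 p).
  have d1 : is_derive p 1 (fun p => parabola r (-1 * p + 1))
      (hinge r (-1 * p + 1) * -1).
    by apply: is_derive_affine; exact: is_derive_parabola.
  have d2 : is_derive p 1 (fun p : R => 2^-1 * (p * p)) p.
    have d3 : is_derive p 1 (fun p : R => p * p) (p *: 1 + p *: 1).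
      exact: (is_deriveM (is_derive_id p 1) (is_derive_id p 1)).
    have d4 := is_deriveM (is_derive_cst (2^-1 : R) p 1) d3.
    apply: (is_derive_eq d4).
    by rewrite scaler0 addr0 /GRing.scale/= -mulr2n; field.
  have -> : g = fun p => 2^-1 * (p * p) - parabola r (-1 * p + 1).
    by apply/funext => q; rewrite /g mulN1r [- q + 1]addrC.
  apply: (is_derive_eq (is_deriveB d2 d1)).
  by rewrite /g1 mulN1r [- p + 1]addrC mulrN1 opprK.
have mono : {homo g1 : u w / u <= w}.
  move=> u w uw; rewrite /g1.
  have le : 1 - w <= 1 - u by lra.
  have [c _] := is_derive_mvt (is_derive_hinge r) le.
  have := step_le1 r c; have : 0 <= w - u by lra.
  move=> h1 h2 E; have := ler_wpM2r h1 h2; rewrite mul1r; lra.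
have := convex_slope_le gg1 mono x0 x1; rewrite /g.
set a := x k in x0 *; set b := x k.+1 in x0 x1 *; set c := x k.+2 in x1 *.
move=> H.
have E1 : (2^-1 * (b * b) - parabola r (1 - b) -
    (2^-1 * (a * a) - parabola r (1 - a))) / (b - a) =
    (a + b) / 2 - (parabola r (1 - b) - parabola r (1 - a)) / (b - a).
  by field; lra.
have E2 : (2^-1 * (c * c) - parabola r (1 - c) -
    (2^-1 * (b * b) - parabola r (1 - b))) / (c - b) =
    (b + c) / 2 - (parabola r (1 - c) - parabola r (1 - b)) / (c - b).
  by field; lra.
rewrite E1 E2 in H; lra.
Qed.

End RampTest.

Section Energy.
Variable R : realType.
Local Notation mu := (@lebesgue_measure R).
Variables (x : nat -> R) (N : nat).
Hypothesis x_incr : forall k, (k.+1 < N)%N -> x k < x k.+1.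
Hypothesis x_in : forall k, (k < N)%N -> 0 < x k < 1.

Lemma le_of_slack (E B A : R) : 0 <= A ->
  (forall e, 0 < e -> 2 * E <= B + E + 2 * (A * e)) -> E <= B.
Proof.
move=> A_ge0 slack.
suff small (e : R) : 0 < e -> E <= B + e by apply/ler_addgt0Pr.
move=> e0.
have e' : 0 < e / (2 * (A + 1)) by rewrite divr_gt0// mulr_gt0//; lra.
have : 2 * (A * (e / (2 * (A + 1)))) <= e.
  have -> : 2 * (A * (e / (2 * (A + 1)))) = e * (A / (A + 1)) by field; lra.
  by apply: ler_piMr; [exact: ltW | rewrite ler_pdivrMr; lra].
have := slack _ e'; lra.
Qed.

(** There are finitely many knots, so one width serves them all and keeps the
    supports of the bumps inside the unit interval. *)
Lemma mollify_close (f : R -> R) (e : R) : {within `[0, 1], continuous f} ->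
  0 < e -> exists (h : R) (r : ramp h), [/\ 0 < h,
    forall k, (k < N)%N -> x k + h < 1 &
    forall j : 'I_N,
      mu.-integrable `]0, 1[ (EFin \o (fun t => f t * bump r (t - x j))) /\
      `|(\int[mu]_(t in `]0, 1[) (f t * bump r (t - x j)))%R - f (x j)| <= e].
Proof.
move=> fc e0.
have near_h : \forall h \near (0 : R)^'+, forall j : 'I_N, x j + h < 1 /\
    forall t, x j <= t -> t <= x j + h -> `|f t - f (x j)| <= e.
  apply: filter_forall => j.
  have /andP[xj0 xj1] := x_in (ltn_ord j).
  have fxj : {for x j, continuous f}.
    apply: within_continuous_continuous fc _; first exact: ltr01.
    by rewrite in_itv/= xj0.
  move/cvgrPdist_le : fxj => /(_ e e0)/nbhs_ballP[d /= d0 Hd].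
  near=> h; split.
    suff : h < 1 - x j by lra.
    by near: h; apply: nbhs_right_lt; lra.
  move=> t t0 t1; rewrite distrC; apply: Hd.
  have hd : h < d by near: h; exact: nbhs_right_lt.
  by rewrite /ball/= ltr_norml; lra.
have [h [h0 Hh]] : exists h : R, 0 < h /\ forall j : 'I_N, x j + h < 1 /\
    forall t, x j <= t -> t <= x j + h -> `|f t - f (x j)| <= e.
  apply: (@have_near _ _ (0 : R)^'+).
  near=> h; exists h; split; first by near: h; exact: nbhs_right_gt.
  by near: h.
have [r] := ramp_exists h0; exists h, r.
have h_small k : (k < N)%N -> x k + h < 1.
  by move=> kN; have [] := Hh (Ordinal kN).
split => // j.
have bc : continuous (fun t => bump r (t - x j)).
  have [g [bg _]] := bump_smooth r 1.
  apply: (is_derive_continuous (g := fun t => g (t - x j))) => t.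
  exact: is_derive_translate (bg _).
have ifb : mu.-integrable `]0, 1[ (EFin \o (fun t => f t * bump r (t - x j))).
  have bw : {within `[0, 1], continuous (fun t => bump r (t - x j))}.
    exact: continuous_subspaceT.
  by apply: integrable_within => t; apply: cvgM; [exact: fc|exact: bw].
split => //.
have ib := integrable_continuous bc.
have b1 := Rintegral_bump x_in r h_small j.
have icb (c : R) :
    mu.-integrable `]0, 1[ (EFin \o (fun t => c * bump r (t - x j))).
  apply: integrable_continuous => t; apply: cvgM; [exact: cvg_cst|exact: bc].
have bound (t : R) :
    `|f t - f (x j)| * bump r (t - x j) <= e * bump r (t - x j).
  have [xt|tx] := leP (x j) t; last first.
    by rewrite bump_out ?mulr0// subr_le0 ltW.
  have [th|ht] := leP t (x j + h); last first.
    by rewrite bump_out ?mulr0// orbC; apply/orP; left; lra.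
  by rewrite ler_wpM2r ?bump_ge0//; have [_] := Hh j; exact.
have up : (\int[mu]_(t in `]0, 1[) (f t * bump r (t - x j)) <=
           \int[mu]_(t in `]0, 1[) ((f (x j) + e) * bump r (t - x j)))%R.
  apply: le_Rintegral => // t _; have := bound t; have := bump_ge0 r (t - x j).
  move: (bump r _) => b b0; have := ler_norm (f t - f (x j)); nra.
have lo : (\int[mu]_(t in `]0, 1[) ((f (x j) - e) * bump r (t - x j)) <=
           \int[mu]_(t in `]0, 1[) (f t * bump r (t - x j)))%R.
  apply: le_Rintegral => // t _; have := bound t; have := bump_ge0 r (t - x j).
  move: (bump r _) => b b0; have := ler_norm (- (f t - f (x j))).
  rewrite normrN; nra.
rewrite RintegralZl ?b1// mulr1 in up; rewrite RintegralZl ?b1// mulr1 in lo.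
by rewrite ler_norml; lra.
Unshelve. all: by end_near. Qed.

Lemma energy_finite (g : R -> R) (B : R) :
  measurable_fun (`]0%R, 1%R[%classic : set R) g ->
  (\int[mu]_(t in `[0%R, 1%R]) (g t ^+ 2)%:E <= B%:E)%E ->
  mu.-integrable `]0, 1[ (EFin \o (fun t => g t ^+ 2)) /\
  (\int[mu]_(t in `]0, 1[) (g t ^+ 2) <= B)%R.
Proof.
move=> mg; rewrite (@integral_itv_bndoo R 0 1 _ true false); last first.
  by apply/measurable_EFinP; exact: measurable_funX.
move=> le; split.
  apply/integrableP; split.
    by apply/measurable_EFinP; exact: measurable_funX.
  under eq_integral => t _ do rewrite /= ger0_norm ?sqr_ge0//.
  exact: le_lt_trans le (ltry _).
rewrite /Rintegral -lee_fin fineK//.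
rewrite ge0_fin_numE ?(le_lt_trans le (ltry _))//.
by apply: integral_ge0 => t _; rewrite lee_fin sqr_ge0.
Qed.

(** Let [v] be the vector of second divided differences of [f] at the knots.
    Testing the weak derivative against the combination of regularised hat
    functions with coefficients [v] gives
    [2 * bending <= B + bending + o(1)]: the hats are nonnegative, sum to at
    most 1 and have at most the mass of the unregularised ones. *)
Lemma bending_sample_le (f g : R -> R) (B : R) :
  {within `[0, 1], continuous f} -> weak_derivative 2 f g ->
  (\int[mu]_(t in `[0%R, 1%R]) (g t ^+ 2)%:E <= B%:E)%E ->
  bending x N (f \o x) <= B.
Proof.
move=> fc [_ [mg _ _] wd] gB.
have [ig2 g2B] := energy_finite mg gB.
have [N2|N2] := leqP N 2.
  rewrite /bending (eqP N2) big_geq// -lee_fin; apply: le_trans gB.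
  by apply: integral_ge0 => t _; rewrite lee_fin sqr_ge0.
(* Choosing [v] to be the divided differences makes the functional of [f] equal
   to the energy [E], and also the weighted sum of squares of [v]. *)
set E := bending _ _ _; pose s k := slope x (f \o x) k.+1 - slope x (f \o x) k.
pose v k := 2 * s k / (x k.+2 - x k).
pose A : R := \sum_(j < N) `|knot_weight x N v j|.
have LE : slope_comb x N v (f \o x) = E.
  by apply: eq_big_nat => k _; rewrite /v /s; ring.
have gap k : (k < N - 2)%N -> 0 < x k.+2 - x k.
  by move=> kN; rewrite subr_gt0 (x_gap2 x_incr).
have vE : \sum_(0 <= k < N - 2) v k ^+ 2 * ((x k.+2 - x k) / 2) = E.
  apply: eq_big_nat => k kN; rewrite /v -/(s k); field.
  by rewrite gt_eqF// gap.
have A_ge0 : 0 <= A by apply: sumr_ge0.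
apply: (le_of_slack A_ge0) => e.
move=> e0; have [h [r [h0 h_small close]]] := mollify_close fc e0.
set J := fun j => (\int[mu]_(t in `]0, 1[) (f t * bump r (t - x j)))%R in close.
pose phi := ramp_test x N r v.
have phiE : derive1n 2 phi =
    fun t => slope_comb x N v (fun j => bump r (t - x j)).
  exact: derive2_ramp_test.
have := wd phi (test_function_ramp_test x_incr x_in r h_small v ltac:(lia)).
rewrite expr2 mulN1r opprK mul1r phiE.
have -> : (\int[mu]_(t in `]0, 1[)
    (f t * slope_comb x N v (fun j => bump r (t - x j))) =
    slope_comb x N v J)%R.
  have [_ H] := @Rintegral_combination _ _ R mu _ (index_enum 'I_N)
    (knot_weight x N v) (fun (j : 'I_N) t => f t * bump r (t - x j))
    `]0, 1[%classic (measurable_itv _) (fun j => (close j).1).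
  rewrite slope_combE -H; apply: eq_Rintegral => t _.
  by rewrite slope_combE mulr_sumr; apply: eq_bigr => j _; ring.
move=> wdE.
have LJ : `|slope_comb x N v J - E| <= A * e.
  rewrite -LE -slope_combB; apply: slope_comb_norm_le => j jN.
  exact: (close (Ordinal jN)).2.
pose u t := slope_comb x N (fun k => v k ^+ 2) (hinge_at x r t).
have hc (j : 'I_N) : continuous (fun t => hinge_at x r t j).
  apply: (is_derive_continuous (g := fun t => step r (t - x j))) => t.
  exact: is_derive_translate (is_derive_hinge r _).
have comb w := @Rintegral_combination _ _ R mu _ (index_enum 'I_N)
    (knot_weight x N w) (fun (j : 'I_N) t => hinge_at x r t j)
    `]0, 1[%classic (measurable_itv _) (fun j => integrable_continuous (hc j)).
have uE w : (fun t => slope_comb x N w (hinge_at x r t)) =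
    fun t => \sum_(j < N) knot_weight x N w j * hinge_at x r t j.
  by apply/funext => t; exact: slope_combE.
have iu : mu.-integrable `]0, 1[ (EFin \o u).
  by rewrite /u uE; exact: (comb _).1.
have ub : (\int[mu]_(t in `]0, 1[) u t <= E)%R.
  rewrite /u uE (comb _).2.
  pose I j := (\int[mu]_(t in `]0, 1[) hinge_at x r t j)%R.
  rewrite -[leLHS](slope_combE x N _ I) -vE; apply: ler_sum_nat => k kN.
  apply: ler_wpM2l; first exact: sqr_ge0.
  exact: (hinge_integral_bend_le x_incr x_in (r := r)).
have pc : continuous phi.
  have -> : phi = fun t => \sum_(j < N) knot_weight x N v j * hinge r (t - x j).
    by apply/funext => t; exact: ramp_testE.
  exact: is_derive_continuous (is_derive_translates _ _ _ (is_derive_hinge r)).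
have mphi : measurable_fun (`]0%R, 1%R[%classic : set R) phi.
  by have /integrableP[/measurable_EFinP] := integrable_continuous pc.
have ip2 : mu.-integrable `]0, 1[ (EFin \o (fun t => phi t ^+ 2)).
  by apply: integrable_continuous => t; apply: cvgM; exact: pc.
have igp : mu.-integrable `]0, 1[ (EFin \o (fun t => 2 * (g t * phi t))).
  have i2 : mu.-integrable `]0, 1[ (EFin \o (fun t => g t ^+ 2 + phi t ^+ 2)).
    exact: integrable_EFinD.
  apply: le_integrable i2 => //.
    apply/measurable_EFinP; apply: measurable_funM => //.
    exact: measurable_funM.
  move=> t _ /=; rewrite lee_fin [leRHS]ger0_norm ?addr_ge0 ?sqr_ge0//.
  by rewrite ler_norml; have := sqr_ge0 (g t - phi t);
    have := sqr_ge0 (g t + phi t); nra.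
have igu : mu.-integrable `]0, 1[ (EFin \o (fun t => g t ^+ 2 + u t)).
  exact: integrable_EFinD.
have ig1 : mu.-integrable `]0, 1[ (EFin \o (fun t => g t * phi t)).
  rewrite (_ : (fun t => _) = fun t => 2^-1 * (2 * (g t * phi t))).
    exact: integrable_EFinZ.
  by apply/funext => t; rewrite [RHS]mulrA mulVf// mul1r.
have : (\int[mu]_(t in `]0, 1[) (2 * (g t * phi t)) <=
        \int[mu]_(t in `]0, 1[) (g t ^+ 2 + u t))%R.
  apply: le_Rintegral => // t _.
  have Hsum := hinge_at_bend_sum x_incr r t N2.
  set H := fun k => slope x (hinge_at x r t) k.+1 - slope x (hinge_at x r t) k
    in Hsum.
  have H0 k : (k < N - 2)%N -> 0 <= H k by exact: hinge_at_bend_ge0.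
  apply: (@le_trans _ _ (\sum_(0 <= k < N - 2) (g t ^+ 2 + v k ^+ 2) * H k)).
    rewrite /phi /ramp_test /slope_comb mulr_sumr mulr_sumr.
    apply: ler_sum_nat => k /andP[_ kN]; rewrite -/(H k).
    by have := H0 k kN; have := sqr_ge0 (g t - v k); nra.
  under eq_bigr do rewrite mulrDl.
  rewrite big_split/= -/(u t) lerD2r -mulr_sumr.
  by rewrite ler_piMr ?sqr_ge0.
rewrite RintegralZl// RintegralD// -wdE.
move: LJ; rewrite ler_norml => /andP[LJ _]; lra.
Qed.

End Energy.

(** * Moment generating function of the noise *)

Section Product.
Context d (T : measurableType d) (R : realType) (P : probability T R).
Local Open Scope ereal_scope.
Import HBNNSimple.

(** The hypothesis on indicators says that [X] is independent of the measure of
    density [h]. It extends to simple functions by linearity and to [g] by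
    monotone convergence. *)
Lemma integral_indep_fun (h : T -> R) (X : T -> R) (H : \bar R) (g : R -> R) :
  (forall w, 0 <= h w)%R -> measurable_fun [set: T] h ->
  measurable_fun [set: T] X -> 0 <= H -> H \is a fin_num ->
  (forall A, measurable A ->
     \int[P]_w (h w * \1_A (X w))%:E = H * P (X @^-1` A)) ->
  (forall u, 0 <= g u)%R -> measurable_fun [set: R] g ->
  \int[P]_w (h w * g (X w))%:E = H * \int[P]_w (g (X w))%:E.
Proof.
move=> h0 mh mX H0 Hfin hH g0 mg.
have mg' : measurable_fun [set: R] (EFin \o g) by exact/measurable_EFinP.
pose f := nnsfun_approx measurableT mg'.
have f_cvg u : (f n u)%:E @[n --> \oo] --> (g u)%:E.
  by apply: (cvg_nnsfun_approx measurableT mg') => // v _; rewrite lee_fin.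
have f_nd u a b : (a <= b)%N -> (f a u <= f b u)%R.
  by move=> ab; exact/lefP/nd_nnsfun_approx.
have mfX n : measurable_fun [set: T] (fun w => f n (X w)).
  exact: measurableT_comp.
have -> : \int[P]_w (g (X w))%:E = limn (fun n => \int[P]_w (f n (X w))%:E).
  under eq_integral => w _ do rewrite -(cvg_lim _ (f_cvg (X w)))//.
  apply: monotone_convergence => //.
  - by move=> n; exact/measurable_EFinP.
  - by move=> n w _; rewrite lee_fin.
  - by move=> w _ a b ab; rewrite lee_fin f_nd.
have -> : \int[P]_w (h w * g (X w))%:E =
    limn (fun n => \int[P]_w (h w * f n (X w))%:E).
  have hf_cvg w : (h w * f n (X w))%:E @[n --> \oo] --> (h w * g (X w))%:E.
    rewrite EFinM; under eq_fun do rewrite EFinM.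
    by apply: cvgeZl => //; exact: f_cvg.
  under eq_integral => w _ do rewrite -(cvg_lim _ (hf_cvg w))//.
  apply: monotone_convergence => //.
  - by move=> n; apply/measurable_EFinP; exact: measurable_funM.
  - by move=> n w _; rewrite lee_fin mulr_ge0.
  - by move=> w _ a b ab; rewrite lee_fin ler_wpM2l// f_nd.
have fE n : \int[P]_w (h w * f n (X w))%:E = H * \int[P]_w (f n (X w))%:E.
  have fsum w : f n (X w) =
      (\sum_(y \in range (f n)) y * \1_(f n @^-1` [set y]) (X w))%R.
    exact: fimfunE.
  have m1 y :
      measurable_fun [set: T] (fun w => \1_(f n @^-1` [set y]) (X w) : R).
    by apply: measurableT_comp => //; exact: measurable_indic.
  have yge0 y w : (0 <= y * \1_(f n @^-1` [set y]) (X w))%R.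
    have [|/negP yr] := boolP (y \in range (f n)).
      by rewrite inE => -[u _ <-]; rewrite mulr_ge0.
    rewrite /indic/= (_ : (X w \in _) = false) ?mulr0//.
    by apply/negP; rewrite inE => fy; apply: yr; rewrite inE; exists (X w).
  transitivity (\sum_(y \in range (f n))
      \int[P]_w ((h w * (y * \1_(f n @^-1` [set y]) (X w)))%:E)).
    rewrite -ge0_integral_fsum//.
    - apply: eq_integral => w _.
      by rewrite fsumEFin// fsum -mulr_fsumr.
    - move=> y; apply/measurable_EFinP; apply: measurable_funM => //.
      exact: measurable_funM.
    - by move=> y w _; rewrite lee_fin mulr_ge0.
  have -> : \int[P]_w (f n (X w))%:E = \sum_(y \in range (f n))
      \int[P]_w ((y * \1_(f n @^-1` [set y]) (X w))%:E).
    rewrite -ge0_integral_fsum//.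
    - by apply: eq_integral => w _; rewrite fsumEFin// fsum.
    - by move=> y; apply/measurable_EFinP; exact: measurable_funM.
    - by move=> y w _; rewrite lee_fin.
  rewrite ge0_mule_fsumr; last first.
    by move=> y; apply: integral_ge0 => w _; rewrite lee_fin.
  apply: eq_fsbigr => y; rewrite inE => -[u _ fu].
  have y0 : (0 <= y)%R by rewrite -fu.
  under eq_integral do rewrite mulrCA EFinM.
  rewrite ge0_integralZl//; first last.
  - by move=> w _; rewrite lee_fin mulr_ge0.
  - by apply/measurable_EFinP; exact: measurable_funM.
  under [in RHS]eq_integral do rewrite EFinM.
  rewrite ge0_integralZl//; first last.
  - by apply/measurable_EFinP.
  rewrite hH//.
  have -> : \int[P]_w (\1_(f n @^-1` [set y]) (X w))%:E =
      P (X @^-1` (f n @^-1` [set y])).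
    have mA : measurable (X @^-1` (f n @^-1` [set y])).
      by rewrite -[X in measurable X]setTI; exact: mX.
    by rewrite -[X in P X]setIT -(integral_indic P measurableT mA).
  by rewrite muleCA.
under eq_fun do rewrite fE.
have cv : cvgn (fun n => \int[P]_w (f n (X w))%:E).
  apply: ereal_nondecreasing_is_cvgn => a b ab.
  apply: ge0_le_integral => //.
  - by move=> w _; rewrite lee_fin.
  - exact/measurable_EFinP.
  - exact/measurable_EFinP.
  - by move=> w _; rewrite lee_fin f_nd.
by apply/cvg_lim => //; apply: cvgeZl.
Qed.

(** Joint induction: the factors [g i] are replaced one at a time by indicators,
    for which the product rule of independence holds. Any choice of sets [A] is
    allowed, since the induction step adds one. *)
Lemma indep_integral_prod_indic n (X : 'I_n -> T -> R) (g : 'I_n -> R -> R)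
    (s : seq 'I_n) (J : {set 'I_n}) (A : 'I_n -> set R) :
  (forall i, measurable_fun [set: T] (X i)) ->
  mutually_independent P X ->
  (forall i u, 0 <= g i u)%R -> (forall i, measurable_fun [set: R] (g i)) ->
  (forall i, \int[P]_w (g i (X i w))%:E \is a fin_num) ->
  uniq s -> (forall i, i \in s -> i \notin J) -> (forall i, measurable (A i)) ->
  \int[P]_w ((\prod_(i <- s) g i (X i w)) *
      \1_[set w | forall i, i \in J -> A i (X i w)] w)%:E =
  (\prod_(i <- s) \int[P]_w (g i (X i w))%:E) *
    \prod_(i in J) P (X i @^-1` A i).
Proof.
move=> mX ind g0 mg gfin.
have mJ (K : {set 'I_n}) (B : 'I_n -> set R) : (forall i, measurable (B i)) ->
    measurable [set w | forall i, i \in K -> B i (X i w)].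
  move=> mB; apply: (@fin_bigcap_measurable _ _ _ [set` K]
    (fun i => X i @^-1` B i)) => // i _.
  by rewrite -[X in measurable X]setTI; exact: mX.
elim: s J A => [|i s IH] J A /=.
  move=> _ _ mA; rewrite big_nil mul1e -ind//.
  under eq_integral do rewrite big_nil mul1r.
  by rewrite (integral_indic P measurableT (mJ _ _ mA)) setIT.
move=> /andP[is_ us] sJ mA.
have iJ : i \notin J by apply: sJ; rewrite mem_head.
set SJ := [set w | _].
under eq_integral => w _ do rewrite big_cons -mulrA mulrC.
rewrite (@integral_indep_fun (fun w => (\prod_(j <- s) g j (X j w)) * \1_SJ w)%R
  (X i) ((\prod_(j <- s) \int[P]_w (g j (X j w))%:E) *
         \prod_(j in J) P (X j @^-1` A j)) (g i))//.
- by rewrite big_cons muleC muleA.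
- by move=> w; rewrite mulr_ge0// prodr_ge0.
- apply: measurable_funM; last by apply: measurable_indic; exact: mJ.
  by apply: measurable_prod => j _; exact: measurableT_comp.
- rewrite mule_ge0//; apply: prode_ge0 => j _ //.
  by apply: integral_ge0 => w _; rewrite lee_fin.
- rewrite fin_numM// prode_fin_num// => j.
  by rewrite fin_num_measure// -[X in measurable X]setTI; exact: mX.
- move=> B mB; pose A' j := if j == i then B else A j.
  have mA' j : measurable (A' j) by rewrite /A'; case: ifP.
  have sJ' j : j \in s -> j \notin i |: J.
    move=> js; rewrite in_setU1 negb_or sJ ?inE ?js ?orbT// andbT.
    by apply: contraNneq is_ => <-.
  have A'i : A' i = B by rewrite /A' eqxx.
  have A'J j : j \in J -> A' j = A j.
    by rewrite /A'; case: eqP => // ->; rewrite (negPf iJ).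
  have := IH (i |: J) A' us sJ' mA'.
  rewrite big_setU1//= A'i => E.
  have -> : \prod_(j in J) P (X j @^-1` A j) =
      \prod_(j in J) P (X j @^-1` A' j).
    by apply: eq_bigr => j jJ; rewrite A'J.
  rewrite -muleA [X in _ = _ * X]muleC -E.
  apply: eq_integral => w _; rewrite -mulrA; congr (_ * _)%:E.
  rewrite !indicE -natrM mulnb; congr ((nat_of_bool _)%:R)%R.
  apply/andP/idP; rewrite !inE.
    move=> [wJ wB] j; rewrite in_setU1 => /predU1P[->|jJ]; first by rewrite A'i.
    by rewrite A'J//; exact: wJ.
  move=> wU; split; last by rewrite -A'i; apply: wU; rewrite in_setU1 eqxx.
  by move=> j jJ; rewrite -A'J//; apply: wU; rewrite in_setU1 jJ orbT.
Qed.

Lemma indep_integral_prod n (X : 'I_n -> T -> R) (g : 'I_n -> R -> R) :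
  (forall i, measurable_fun [set: T] (X i)) ->
  mutually_independent P X ->
  (forall i u, 0 <= g i u)%R -> (forall i, measurable_fun [set: R] (g i)) ->
  (forall i, \int[P]_w (g i (X i w))%:E \is a fin_num) ->
  \int[P]_w (\prod_i g i (X i w))%:E = \prod_i \int[P]_w (g i (X i w))%:E.
Proof.
move=> mX ind g0 mg gfin.
have := @indep_integral_prod_indic n X g (index_enum 'I_n) finset.set0
  (fun=> setT)
  mX ind g0 mg gfin (index_enum_uniq _).
rewrite big_set0 mule1 => <-// => [|i _]; last by rewrite finset.in_set0.
apply: eq_integral => w _; rewrite indicE (_ : w \in _) ?mulr1//.
by rewrite inE => i; rewrite finset.in_set0.
Qed.

End Product.

Section ExpMoment.
Variable R : realType.

Definition exp_moment_cst : R := 2 * expR 2^-1 / (1 - expR (- 4^-1)).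

Lemma exp_quarter_lt1 : expR (- 4^-1) < 1 :> R.
Proof. by rewrite expR_lt1 oppr_lt0 invr_gt0. Qed.

Lemma exp_moment_cst_gt0 : 0 < exp_moment_cst.
Proof.
by rewrite divr_gt0 ?subr_gt0 ?exp_quarter_lt1// mulr_gt0// expR_gt0.
Qed.

(** Linearising the Gaussian square at the integer nearest below [|y|] loses
    only a constant factor. *)
Definition square_term (y : R) (j : nat) : R :=
  expR 2^-1 *
  (expR (j%:R * y - j%:R ^+ 2 / 2) + expR (- j%:R * y - j%:R ^+ 2 / 2)).

Lemma square_term_ge0 y j : 0 <= square_term y j.
Proof. by rewrite mulr_ge0 ?addr_ge0 ?expR_ge0. Qed.

Lemma expR_sqr_le_term (y : R) :
  expR (y ^+ 2 / 2) <= square_term y (Num.truncn `|y|).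
Proof.
set j := Num.truncn _; rewrite /square_term mulrDr -!expRD.
have /andP[j1 j2] := truncn_itv (normr_ge0 y); rewrite -/j in j1 j2.
have {}j2 : `|y| < j%:R + 1 by rewrite natr1.
set a : R := j%:R in j1 j2 *.
have key : y ^+ 2 / 2 <= 2^-1 + (a * `|y| - a ^+ 2 / 2).
  by rewrite -[y ^+ 2]real_normK ?num_real//; nra.
apply: le_trans (_ : expR (2^-1 + (a * `|y| - a ^+ 2 / 2)) <= _).
  by rewrite ler_expR.
have [y0|y0] := leP 0 y; first by rewrite ger0_norm// lerDl expR_ge0.
by rewrite ltr0_norm// mulrN -mulNr lerDr expR_ge0.
Qed.

Lemma geometric_sum_le (q : R) m : 0 <= q < 1 ->
  \sum_(0 <= j < m) q ^+ j <= (1 - q)^-1.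
Proof.
move=> /andP[q0 q1]; rewrite -[leRHS]mul1r ler_pdivlMr ?subr_gt0// big_mkord.
have := subrX1 q m; have := exprn_ge0 m q0; lra.
Qed.

Context d (T : measurableType d) (P : probability T R).
Local Open Scope ereal_scope.

(** The expectation of the [j]-th linear term is at most
    [exp (j ^ 2 / 4 - j ^ 2 / 2)], up to a constant, and these are dominated by
    a geometric series. *)
Lemma exp_moment_le (V : T -> R) : measurable_fun [set: T] V ->
  (forall t, \int[P]_w (expR (t * V w))%:E <= (expR (t ^+ 2 / 4))%:E) ->
  \int[P]_w (expR (V w ^+ 2 / 2))%:E <= exp_moment_cst%:E.
Proof.
move=> mV mgf.
have mexp (a b : R) : measurable_fun [set: T] (fun w => expR (a * V w - b)).
  apply: (measurableT_comp (@measurable_expR R)).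
  by apply: measurable_funB => //; exact: measurable_funM.
have mterm j : measurable_fun [set: T] (fun w => square_term (V w) j).
  by apply: measurable_funM => //; exact: measurable_funD.
apply: (@le_trans _ _ (\int[P]_w \sum_(j <oo) (square_term (V w) j)%:E)).
  apply: ge0_le_integral => //.
  - apply/measurable_EFinP; apply: (measurableT_comp (@measurable_expR R)).
    by apply: measurable_funM => //; exact: measurable_funX.
  - apply: ge0_emeasurable_sum => //.
    + by move=> j w _ _; rewrite lee_fin square_term_ge0.
    + by move=> j _; exact/measurable_EFinP.
  - move=> w _; set j := Num.truncn `|V w|%R.
    apply: (@le_trans _ _ (\sum_(0 <= k < j.+1) (square_term (V w) k)%:E)).
      rewrite big_nat_recr//= -[X in X <= _]add0e.
      rewrite leeD ?lee_fin ?expR_sqr_le_term//.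
      by apply: sume_ge0 => k _; rewrite lee_fin square_term_ge0.
    by apply: nneseries_lim_ge => k _ _; rewrite lee_fin square_term_ge0.
rewrite integral_nneseries//; last 2 first.
- by move=> j; exact/measurable_EFinP.
- by move=> j w _; rewrite lee_fin square_term_ge0.
have term_le j : \int[P]_w (square_term (V w) j)%:E <=
    (2 * expR 2^-1 * expR (- 4^-1) ^+ j)%:E.
  have shifted (s : R) : (s ^+ 2 = j%:R ^+ 2)%R ->
      \int[P]_w (expR (s * V w - j%:R ^+ 2 / 2))%:E <= (expR (- 4^-1) ^+ j)%:E.
    move=> sj; under eq_integral do rewrite expRD mulrC EFinM.
    rewrite ge0_integralZl//; last first.
      apply/measurable_EFinP; apply: (measurableT_comp (@measurable_expR R)).
      exact: measurable_funM.
    apply: (@le_trans _ _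
        ((expR (- (j%:R ^+ 2 / 2)))%:E * (expR (s ^+ 2 / 4))%:E)).
      by apply: lee_pmul; rewrite ?lee_fin ?expR_ge0//;
        apply: integral_ge0 => w _;
        rewrite lee_fin expR_ge0.
    rewrite -EFinM lee_fin -expRD sj -expRM_natl ler_expR.
    have : (j%:R <= j%:R ^+ 2 :> R)%R.
      by rewrite -natrX ler_nat; case: (j) => // k; rewrite leq_pmulr.
    lra.
  under eq_integral do rewrite /square_term EFinM EFinD.
  rewrite ge0_integralZl//; last 2 first.
  - by apply: emeasurable_funD; exact/measurable_EFinP.
  - by move=> w _; rewrite -EFinD lee_fin addr_ge0 ?expR_ge0.
  rewrite ge0_integralD//; last 2 first.
  - exact/measurable_EFinP.
  - exact/measurable_EFinP.
  apply: (@le_trans _ _ ((expR 2^-1)%:E *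
      ((expR (- 4^-1) ^+ j)%:E + (expR (- 4^-1) ^+ j)%:E))).
    rewrite lee_pmul2l// ?lte_fin ?expR_gt0//.
    by apply: leeD; apply: shifted => //; rewrite sqrrN.
  by rewrite -EFinD -EFinM lee_fin; lra.
apply: lime_le.
  apply: is_cvg_nneseries => j _ _; apply: integral_ge0 => w _.
  by rewrite lee_fin square_term_ge0.
apply: nearW => m; apply: (@le_trans _ _
    (\sum_(0 <= j < m) (2 * expR 2^-1 * expR (- 4^-1) ^+ j)%:E)).
  by apply: lee_sum => j _; exact: term_le.
rewrite sumEFin lee_fin -mulr_sumr ler_wpM2l ?mulr_ge0 ?expR_ge0//.
by apply: geometric_sum_le; rewrite expR_ge0 exp_quarter_lt1.
Qed.

End ExpMoment.

Lemma measurable_superlevel d (T : measurableType d) (R : realType)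
    (f : T -> R) (u : R) :
  measurable_fun [set: T] f -> measurable [set w | u < f w].
Proof.
move=> mf; have := mf measurableT `]u, +oo[%classic (measurable_itv _).
congr (measurable _); apply/seteqP.
by split => w /=; rewrite in_itv/= andbT // => -[].
Qed.

Section QuadraticTail.
Context d (T : measurableType d) (R : realType) (P : probability T R).
Variables (n : nat) (K : R) (eps : 'I_n -> {RV P >-> R}).
Hypothesis eps_ind : mutually_independent P eps.
Hypothesis eps_sub : forall i, subgaussian P K (eps i).
Local Open Scope ereal_scope.

Lemma mgf_linear_le (a : 'I_n -> R) :
  \int[P]_w (expR (\sum_i a i * eps i w))%:E <=
    (expR (K ^+ 2 / 2 * \sum_i a i ^+ 2))%:E.
Proof.
have mgf_i i : \int[P]_w (expR (a i * eps i w))%:E <=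
    (expR (K ^+ 2 / 2 * a i ^+ 2))%:E.
  have := eps_sub i (a i); rewrite /mmt_gen_fun unlock.
  rewrite (_ : K ^+ 2 * a i ^+ 2 / 2 = K ^+ 2 / 2 * a i ^+ 2)%R; last by ring.
  apply: le_trans; rewrite le_eqVlt; apply/orP; left; apply/eqP.
  by apply: eq_integral => w _ /=; rewrite mulrC.
under eq_integral do rewrite expR_sum.
rewrite (@indep_integral_prod _ _ _ P n eps (fun i u => expR (a i * u)))//.
- rewrite mulr_sumr expR_sum -prodEFin.
  suff: 0 <= \prod_i \int[P]_w (expR (a i * eps i w))%:E <=
      \prod_i (expR (K ^+ 2 / 2 * a i ^+ 2))%:E by case/andP.
  elim/big_ind2: _ => [|x1 x2 y1 y2 /andP[x0 xx] /andP[y0 yy]|i _].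
  - by rewrite lee_fin ler01/=.
  - by rewrite mule_ge0//= lee_pmul.
  - rewrite mgf_i andbT.
    by apply: integral_ge0 => w _; rewrite lee_fin expR_ge0.
- move=> i; apply: (measurableT_comp (@measurable_expR R)).
  exact: measurable_funM.
- move=> i; rewrite ge0_fin_numE; first exact: le_lt_trans (mgf_i i) (ltry _).
  by apply: integral_ge0 => w _; rewrite lee_fin expR_ge0.
Qed.

(** Convexity of the exponential reduces the quadratic form to its rows: each
    normalised row is a sub-Gaussian variable, and the weights sum to 1. *)
Lemma quadratic_tail (A : 'M[R]_n) (K1 tau u : R) :
  (0 < K1)%R -> (K ^+ 2 <= K1)%R -> (0 < tau)%R -> (0 <= u)%R ->
  (\sum_k \sum_j A k j ^+ 2 <= tau)%R ->
  P [set w | (u < sqnorm2 (A *m (\col_i eps i w)))%R] <=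
    (exp_moment_cst R * expR (- (u / (4 * K1 * tau))))%:E.
Proof.
move=> K1_gt0 KK1 tau_gt0 u_ge0.
pose t k : R := (\sum_j A k j ^+ 2)%R; pose S : R := (\sum_k t k)%R.
rewrite -/S => Stau.
have t_ge0 k : (0 <= t k)%R by apply: sumr_ge0 => j _; exact: sqr_ge0.
have S_ge0 : (0 <= S)%R by apply: sumr_ge0.
pose Z k w : R := (\sum_j A k j * eps j w)%R.
have normE w : sqnorm2 (A *m (\col_i eps i w)) = (\sum_k Z k w ^+ 2)%R.
  apply: eq_bigr => k _; rewrite mxE; congr (_ ^+ 2)%R.
  by apply: eq_bigr => j _; rewrite mxE.
have mZ k : measurable_fun [set: T] (Z k).
  by apply: measurable_sum => j; exact: measurable_funM.
have Z_eq0 k w : t k = 0%R -> Z k w = 0%R.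
  move=> /eqP; rewrite psumr_eq0 => [/allP tk|j _]; last exact: sqr_ge0.
  rewrite /Z big1// => j _; have := tk j (mem_index_enum _).
  by rewrite /= sqrf_eq0 => /eqP->; rewrite mul0r.
have [S0|Sn0] := eqVneq S 0%R.
  have Znull k w : Z k w = 0%R.
    apply: Z_eq0; move/eqP: S0; rewrite psumr_eq0 => [/allP/(_ k)|//].
    by rewrite mem_index_enum => /(_ isT)/eqP.
  rewrite (_ : [set w | _] = set0) ?measure0; last first.
    apply/seteqP; split => // w /=; rewrite normE big1 => [|k _].
      by rewrite ltNge u_ge0.
    by rewrite Znull expr0n.
  by rewrite lee_fin mulr_ge0 ?expR_ge0// ltW// exp_moment_cst_gt0.
have S_gt0 : (0 < S)%R by rewrite lt0r Sn0.
(* With this normalisation the moment generating function of [Y k] at [s] is at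
   most [exp (s ^ 2 / 4)], as [exp_moment_le] demands. *)
pose r k : R := Num.sqrt (2 * K1 * t k).
pose Y k w : R := (Z k w / r k)%R.
have mY k : measurable_fun [set: T] (Y k) by exact: measurable_funM.
have r2 k : (r k ^+ 2 = 2 * K1 * t k)%R.
  by rewrite sqr_sqrtr// mulr_ge0// mulr_ge0// ltW.
have YE k w : (Z k w ^+ 2 = 2 * K1 * t k * Y k w ^+ 2)%R.
  have [tk0|tkn0] := eqVneq (t k) 0%R.
    by rewrite tk0 mulr0 mul0r Z_eq0// expr0n.
  rewrite -r2 /Y -exprMn mulrC divfK// sqrtr_eq0 -ltNge.
  by rewrite mulr_gt0 ?mulr_gt0// lt0r tkn0 t_ge0.
have Ymoment k : \int[P]_w (expR (Y k w ^+ 2 / 2))%:E <= (exp_moment_cst R)%:E.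
  apply: exp_moment_le => // s.
  have -> : (fun w => (expR (s * Y k w))%:E) =
      fun w => (expR (\sum_j (s / r k * A k j) * eps j w))%:E.
    apply/funext => w; rewrite /Y /Z mulr_suml mulr_sumr.
    by congr (expR _)%:E; apply: eq_bigr => j _; ring.
  apply: le_trans (mgf_linear_le _) _; rewrite lee_fin ler_expR.
  under eq_bigr do rewrite exprMn; rewrite -mulr_sumr -/(t k) expr_div_n r2.
  have [->|tkn0] := eqVneq (t k) 0%R.
    by rewrite !mulr0; rewrite divr_ge0 ?sqr_ge0.
  rewrite (_ : _ * _ = (K ^+ 2 / K1) * (s ^+ 2 / 4))%R; last first.
    by field; rewrite tkn0 gt_eqF.
  by rewrite ler_piMl ?divr_ge0 ?sqr_ge0// ler_pdivrMr// mul1r.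
pose c : R := ((4 * K1 * S)^-1)%R.
have jensen w : (expR (c * \sum_k Z k w ^+ 2) <=
    \sum_k t k / S * expR (Y k w ^+ 2 / 2))%R.
  set m := (c * _)%R.
  have mE : m = (\sum_k t k / S * (Y k w ^+ 2 / 2))%R.
    rewrite /m mulr_sumr; apply: eq_bigr => k _; rewrite YE /c; field.
    by rewrite !gt_eqF.
  have w1 : (\sum_k t k / S = 1)%R by rewrite -mulr_suml divff// gt_eqF.
  (* Compare the exponential with its tangent at the mean [m]. *)
  apply: (@le_trans _ _
      (\sum_k t k / S * (expR m * (1 + (Y k w ^+ 2 / 2 - m))))%R).
    rewrite le_eqVlt; apply/orP; left; apply/eqP.
    rewrite (eq_bigr (fun k => expR m * (t k / S * (Y k w ^+ 2 / 2)) +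
        expR m * (1 - m) * (t k / S)))%R; last by move=> k _; ring.
    by rewrite big_split/= -!mulr_sumr w1 -mE; ring.
  apply: ler_sum => k _; apply: ler_wpM2l; first by rewrite divr_ge0.
  have := expR_ge1Dx (Y k w ^+ 2 / 2 - m).
  move=> /(ler_wpM2l (expR_ge0 m)) /le_trans; apply.
  by rewrite -expRD addrCA subrr addr0.
have mW : measurable_fun [set: T] (fun w => \sum_k Z k w ^+ 2)%R.
  by apply: measurable_sum => k; exact: measurable_funX.
have mset : measurable [set w | (u < sqnorm2 (A *m (\col_i eps i w)))%R].
  by under eq_set do rewrite normE; exact: measurable_superlevel.
rewrite -[X in P X]setIT -(integral_indic P measurableT mset).
pose B : R := expR (- (c * u))%R.
have mYe k : measurable_fun [set: T] (fun w => (expR (Y k w ^+ 2 / 2))).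
  apply: (measurableT_comp (@measurable_expR R)).
  by apply: measurable_funM => //; exact: measurable_funX.
apply: (@le_trans _ _ (\int[P]_w
    (\sum_k (B * (t k / S))%:E * (expR (Y k w ^+ 2 / 2))%:E))).
  apply: ge0_le_integral => //.
  - exact/measurable_EFinP/measurable_indic.
  - apply: emeasurable_sum => k; apply: emeasurable_funM => //.
    exact/measurable_EFinP.
  - move=> w _; under eq_bigr do rewrite -EFinM -mulrA.
    rewrite sumEFin lee_fin -mulr_sumr indicE.
    have [wE|_] := boolP (w \in _); last first.
      rewrite mulr_ge0 ?expR_ge0// sumr_ge0// => k _.
      by rewrite mulr_ge0 ?expR_ge0// divr_ge0.
    apply: le_trans (_ : B * expR (c * \sum_k Z k w ^+ 2) <= _)%R; last first.
      by rewrite ler_wpM2l ?expR_ge0.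
    rewrite -expRD -[leLHS]expR0 ler_expR addrC subr_ge0.
    move: wE; rewrite inE/= normE => /ltW uW.
    by rewrite ler_wpM2l// invr_ge0 !mulr_ge0// ltW.
rewrite ge0_integral_sum//; last 2 first.
- by move=> k; apply: emeasurable_funM => //; exact/measurable_EFinP.
- by move=> k w _; rewrite -EFinM lee_fin !mulr_ge0 ?expR_ge0// invr_ge0.
apply: (@le_trans _ _ (\sum_k (B * (t k / S))%:E * (exp_moment_cst R)%:E)).
  apply: lee_sum => k _; rewrite ge0_integralZl//; last 2 first.
  - exact/measurable_EFinP.
  - by rewrite lee_fin mulr_ge0 ?expR_ge0// divr_ge0.
  by rewrite lee_wpmul2l// lee_fin mulr_ge0 ?expR_ge0// divr_ge0.
under eq_bigr do rewrite -EFinM.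
rewrite sumEFin lee_fin -mulr_suml -mulr_sumr -mulr_suml divff ?gt_eqF//.
rewrite mulr1 mulrC ler_wpM2l//; first by rewrite ltW// exp_moment_cst_gt0.
rewrite ler_expR lerN2 mulrC ler_wpM2r// /c lef_pV2 ?posrE ?mulr_gt0//.
by rewrite ler_wpM2l// mulr_ge0// ltW.
Qed.

End QuadraticTail.

(** * Freezing one of two independent variables *)

Section Freeze.
Context d (T : measurableType d) (R : realType) (P : probability T R).
Context d1 d2 (S1 : measurableType d1) (S2 : measurableType d2).
Local Open Scope ereal_scope.

(** The joint law of independent [f] and [g] is the product of their laws, so
    the probability of [E] is the mean over [f] of the probabilities of its
    sections. *)
Lemma indep_section_le (f : T -> S1) (g : T -> S2) (E : set (S1 * S2))
    (delta : \bar R) :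
  measurable_fun [set: T] f -> measurable_fun [set: T] g ->
  (forall A B, measurable A -> measurable B ->
     P (f @^-1` A `&` g @^-1` B) = P (f @^-1` A) * P (g @^-1` B)) ->
  measurable E ->
  (forall w, P [set w' | E (f w, g w')] <= delta) ->
  P [set w | E (f w, g w)] <= delta.
Proof.
move=> mf mg fg mE Edelta.
pose fM : {mfun T >-> S1} := HB.pack f (isMeasurableFun.Build _ _ _ _ _ mf).
pose gM : {mfun T >-> S2} := HB.pack g (isMeasurableFun.Build _ _ _ _ _ mg).
have mp : measurable_fun [set: T] (fun w => (f w, g w)).
  exact: measurable_fun_pair.
pose pM : {mfun T >-> (S1 * S2)%type} :=
  HB.pack (fun w => (f w, g w)) (isMeasurableFun.Build _ _ _ _ _ mp).
have joint A B : measurable A -> measurable B ->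
    distribution P pM (A `*` B) = distribution P fM A * distribution P gM B.
  by move=> mA mB; exact: fg.
have -> : P [set w | E (f w, g w)] = distribution P pM E by [].
rewrite -(product_measure_unique joint mE).
rewrite /product_measure1 ge0_integral_distribution//; last first.
  exact: measurable_fun_xsection.
apply: (@le_trans _ _ (\int[P]_w cst delta w)).
  apply: ge0_le_integral => //.
  - by apply: (measurableT_comp _ mf); exact: measurable_fun_xsection.
  - move=> w _ /=; have := Edelta w.
    rewrite (_ : [set w' | E (f w, g w')] = g @^-1` xsection E (f w))//.
    by apply/seteqP; split => w' /=; rewrite /xsection/= inE.
by rewrite integral_cst// [X in _ * X](@probability_setT _ _ _ P) mule1.
Qed.

End Freeze.

(** * Order statistics *)

Section OrderStatistics.
Context d (T : measurableType d) (R : realType) (P : probability T R).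
Variables (n : nat) (U : 'I_n -> T -> R).
Hypothesis mU : forall i, measurable_fun [set: T] (U i).

Let sample w := [seq U j w | j <- enum 'I_n].

Lemma size_sample w : size (sort <=%R (sample w)) = n.
Proof. by rewrite size_sort size_map size_enum_ord. Qed.

(** Counting replaces sorting, which makes the order statistics measurable. *)
Lemma order_statistics_le w (i : 'I_n) (t : R) :
  (order_statistics U w i 0 <= t) =
  (i%:R < \sum_(j < n) \1_[set w | U j w <= t] w :> R).
Proof.
rewrite mxE; set s := sort _ _.
have ss : sorted <=%R s by exact: sort_le_sorted.
have -> : \sum_(j < n) \1_[set w | U j w <= t] w =
    (count (fun v => v <= t) s)%:R :> R.
  rewrite (permP (permEl (perm_sort <=%R (sample w)))) count_map -sum1_count.
  rewrite [in RHS]big_mkcond [in RHS]big_enum/= natr_sum; apply: eq_bigr => j _.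
  rewrite indicE; case: ifP => Ujt; first by rewrite mem_set.
  by rewrite memNset//= Ujt.
rewrite ltr_nat; apply/idP/idP => [|lt]; last exact: nth_count_le.
apply: contraTT; rewrite -leqNgt -ltNge => ge.
by apply: nth_count_gt => //; rewrite ge/= size_sample.
Qed.

Lemma measurable_order_statistics (i : 'I_n) :
  measurable_fun [set: T] (fun w => order_statistics U w i 0).
Proof.
apply: (measurability _ (RGenOInfty.measurableE R)) => //.
move=> _ [_ [t ->] <-]; rewrite setTI.
have -> : (fun w => order_statistics U w i 0) @^-1` `]t, +oo[ =
    (fun w => \sum_(j < n) \1_[set w | U j w <= t] w : R) @^-1` `]-oo, i%:R].
  by apply/seteqP; split => w; rewrite /= !in_itv/= andbT ltNge
    order_statistics_le -leNgt.
rewrite -[X in measurable X]setTI.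
have mS : measurable_fun [set: T]
    (fun w => \sum_(j < n) \1_[set w | U j w <= t] w : R).
  apply: measurable_sum => j; apply: measurable_indic.
  rewrite (_ : [set w | U j w <= t] = [set: T] `&` U j @^-1` `]-oo, t]).
    exact: mU.
  by rewrite setTI; apply/seteqP; split => w /=; rewrite in_itv.
exact: mS.
Qed.

Lemma order_statistics_sorted w (i j : 'I_n) : (i <= j)%N ->
  order_statistics U w i 0 <= order_statistics U w j 0.
Proof.
move=> ij; rewrite !mxE.
have ss : sorted <=%R (sort <=%R (sample w)) by exact: sort_le_sorted.
by apply: (sorted_leq_nth le_trans le_refl 0 ss) => //; rewrite inE size_sample.
Qed.

Lemma order_statistics_range w (i : 'I_n) :
  exists j : 'I_n, order_statistics U w i 0 = U j w.
Proof.
rewrite mxE; have : nth 0 (sort <=%R (sample w)) i \in sort <=%R (sample w).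
  by rewrite mem_nth// size_sample.
by rewrite mem_sort => /mapP[j _ ->]; exists j.
Qed.

Lemma order_statistics_strict w : injective (U^~ w) ->
  strictly_increasing (order_statistics U w).
Proof.
move=> inj i j ij.
rewrite lt_neqAle (order_statistics_sorted _ (ltnW ij)) andbT !mxE.
rewrite nth_uniq ?size_sample//; first by rewrite neq_ltn ij.
by rewrite sort_uniq map_inj_uniq// enum_uniq.
Qed.

End OrderStatistics.

Definition regular_design (R : realType) n (x : 'cV[R]_n) : Prop :=
  strictly_increasing x /\ forall i, 0 < x i 0 < 1.

Lemma measurable_regular_design d (T : measurableType d) (R : realType) n
    (x : T -> 'cV[R]_n) :
  (forall i, measurable_fun [set: T] (fun w => x w i 0)) ->
  measurable [set w | regular_design (x w)].
Proof.
move=> mx.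
have mlt (f g : T -> R) : measurable_fun [set: T] f ->
    measurable_fun [set: T] g -> measurable [set w | f w < g w].
  move=> mf mg; under eq_set do rewrite -subr_gt0.
  by apply: measurable_superlevel; exact: measurable_funB.
have -> : [set w | regular_design (x w)] =
    (\bigcap_(p in [set p : 'I_n * 'I_n | (p.1 < p.2)%N])
       [set w | x w p.1 0 < x w p.2 0]) `&`
    (\bigcap_(i in [set: 'I_n])
       ([set w | 0 < x w i 0] `&` [set w | x w i 0 < 1])).
  apply/seteqP; split => w /=.
    move=> [xi x01]; split => [[i j] /= ij|i _ /=]; first exact: xi.
    by have /andP[] := x01 i.
  move=> [xi x01]; split => [i j ij|i]; first exact: (xi (i, j)).
  by apply/andP; have [] := x01 i I.
apply: measurableI; apply: fin_bigcap_measurable => //.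
  by move=> p _; exact: mlt.
by move=> i _; apply: measurableI; apply: mlt.
Qed.

Section NullEvents.
Context d (T : measurableType d) (R : realType) (P : probability T R).
Local Open Scope ereal_scope.

(** An atom at [a] would be a jump of the distribution function. *)
Lemma continuous_cdf_atomless (X : {RV P >-> R}) (a : R) :
  continuous (cdf X) -> P [set w | X w = a] = 0.
Proof.
move=> cX; rewrite probability_distribution; set m := distribution P X.
have mfin A : measurable A -> m A \is a fin_num.
  by move=> mA; exact: fin_num_measure.
have le u : (u < a)%R -> m [set a] + cdf X u <= cdf X a.
  move=> ua; rewrite /cdf -/m -measureU//.
    apply: le_measure; rewrite ?inE//; first exact: measurableU.
    move=> v /= [->|]; rewrite !in_itv/= ?lexx//.
    by move=> /le_trans; apply; exact: ltW.
  apply/seteqP; split => // v [/= ->]; rewrite in_itv/=.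
  by rewrite leNgt ua.
have cv : (m [set a] + cdf X u) @[u --> a^'-] --> m [set a] + cdf X a.
  apply: cvgeD; [|exact: cvg_cst|by apply: cvg_at_left_filter; exact: cX].
  by rewrite fin_num_adde_defr// mfin.
have : m [set a] + cdf X a <= cdf X a.
  rewrite -(cvg_lim _ cv)//; apply: lime_le.
    by apply/cvg_ex; eexists; exact: cv.
  by near=> u; apply: le; near: u; exact: nbhs_left_lt.
rewrite -[leRHS]add0e leeD2rE ?mfin// => le0.
by apply/eqP; rewrite eq_le le0 measure_ge0.
Unshelve. all: by end_near. Qed.

Variables (n : nat) (U : 'I_n -> {RV P >-> R}).
Hypothesis U_ind : mutually_independent P U.
Hypothesis U_cont : forall i, continuous (cdf (U i)).
Hypothesis U_in : forall i, distribution P (U i) `[0%R, 1%R] = 1.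

(** Freeze [U i]: its value is then not an atom of [U j]. *)
Lemma collision_null i j : i != j -> P [set w | U i w = U j w] = 0.
Proof.
move=> ij; apply/eqP; rewrite eq_le measure_ge0 andbT.
pose D : set (R * R) := [set z | z.1 = z.2].
have mD : measurable D.
  have mf : measurable_fun [set: R * R] (fun z : R * R => z.1 - z.2)%R.
    by apply: measurable_funB; [exact: measurable_fst|exact: measurable_snd].
  rewrite (_ : D =
      [set: R * R] `&` (fun z : R * R => z.1 - z.2)%R @^-1` [set 0%R]).
    exact: mf.
  rewrite setTI; apply/seteqP; split => z /=; last by move/subr0_eq.
  by rewrite /D/= => ->; rewrite subrr.
apply: (@indep_section_le _ _ _ P _ _ R R (U i) (U j) D 0) => //.
  move=> A B mA mB; pose C k := if k == i then A else B.
  have := @U_ind [set i; j]%SET C.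
  have mC k : measurable (C k) by rewrite /C; case: ifP.
  move=> /(_ mC); rewrite big_setU1 ?inE//= big_set1.
  rewrite {2}/C eqxx {2}/C eq_sym (negPf ij) => <-.
  congr (P _); apply/seteqP; split => w /=.
    move=> [wA wB] k; rewrite !inE => /orP[/eqP->|/eqP->]; rewrite /C ?eqxx//.
    by rewrite eq_sym (negPf ij).
  move=> wC; split.
    by have := wC i; rewrite !inE eqxx /C eqxx => /(_ isT).
  by have := wC j; rewrite !inE eqxx orbT /C eq_sym (negPf ij) => /(_ isT).
move=> w; rewrite (_ : [set w' | _] = [set w' | U j w' = U i w]).
  by rewrite continuous_cdf_atomless.
by apply/seteqP; split => w' /=; rewrite /D/=.
Qed.

Lemma in_open_unit_ae i : {ae P, forall w, (0 < U i w < 1)%R}.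
Proof.
have m01 : measurable ((U i : T -> R) @^-1` `[0%R, 1%R]).
  by rewrite -[X in measurable X]setTI; exact: measurable_funP.
have n01 : P.-negligible (~` ((U i : T -> R) @^-1` `[0%R, 1%R])).
  have out0 : P (~` ((U i : T -> R) @^-1` `[0%R, 1%R])) = 0.
    rewrite (probability_setC P m01) -[RHS](@subee _ 1)//; congr (1 - _).
    exact: U_in.
  exists (~` ((U i : T -> R) @^-1` `[0%R, 1%R])); split => //.
  exact: measurableC.
have atom a : P.-negligible [set w | U i w = a].
  apply/negligibleP; last exact: continuous_cdf_atomless.
  rewrite (_ : [set w | _] = [set: T] `&` (U i : T -> R) @^-1` [set a]).
    exact: measurable_funP.
  by rewrite setTI; apply/seteqP; split.
apply: negligibleS (negligibleU n01 (negligibleU (atom 0%R) (atom 1%R))).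
move=> w /= w01.
have [in01|] := pselect (`[0%R, 1%R]%classic (U i w)); last by left.
right; move: in01; rewrite /= in_itv/= !le_eqVlt.
move=> /andP[/predU1P[/esym u0|u0]].
  by left.
move=> /predU1P[u1|u1]; first by right.
by exfalso; apply: w01; rewrite u0.
Qed.

Lemma regular_design_ae :
  {ae P, forall w, regular_design (order_statistics U w)}.
Proof.
have dist : {ae P, forall w, forall p : 'I_n * 'I_n,
    p.1 != p.2 -> U p.1 w <> U p.2 w}.
  apply: (@filter_forall _ _ (fun (p : 'I_n * 'I_n) w =>
    p.1 != p.2 -> U p.1 w <> U p.2 w)).
  move=> [i j] /=; have [->|ij] := eqVneq i j; first exact: aeW.
  have : P.-negligible [set w | U i w = U j w].
    apply/negligibleP; last exact: collision_null.
    rewrite (_ : [set w | _] =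
        [set: T] `&` (fun w => U i w - U j w)%R @^-1` [set 0%R]).
      exact: measurable_funB.
    rewrite setTI; apply/seteqP; split => w /=; last by move/subr0_eq.
    by move=> ->; rewrite subrr.
  by apply: negligibleS => w /= /not_implyP[_ /contrapT].
have inside : {ae P, forall w, forall i, (0 < U i w < 1)%R}.
  apply: (@filter_forall _ _ (fun i w => (0 < U i w < 1)%R : Prop)).
  exact: in_open_unit_ae.
apply: filterS2 dist inside => w dist inside; split.
  apply: order_statistics_strict => i j Uij.
  by apply/eqP/negPn/negP => /(dist (i, j)).
move=> i; have [j ->] := order_statistics_range U w i; exact: inside.
Qed.

End NullEvents.

(** * The smoother as a measurable function of the design *)

Section MeasurableMatrix.
Context d (T : measurableType d) (R : realType).

(** Inversion is continuous off 0, and the remaining point is a measurable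
    set. *)
Lemma measurable_invr (f : T -> R) : measurable_fun [set: T] f ->
  measurable_fun [set: T] (fun w => (f w)^-1).
Proof.
move=> mf; apply: (measurableT_comp _ mf).
have -> : [set: R] = [set x : R | x != 0] `|` [set 0].
  apply/seteqP; split => // x _ /=.
  by have [->|x0] := eqVneq x 0; [right|left].
have o0 : open [set x : R | x != 0].
  rewrite (_ : [set x : R | x != 0] = ~` [set 0]); last first.
    by apply/seteqP; split => x /= /eqP.
  exact/closed_openC/closed_eq.
apply/measurable_funU => //; first exact: open_measurable.
split; last exact: measurable_fun_set1.
apply: open_continuous_measurable_fun => // x; rewrite inE/= => x0.
exact: inv_continuous.
Qed.

Definition measurable_mx m n (A : T -> 'M[R]_(m, n)) : Prop :=
  forall i j, measurable_fun [set: T] (fun w => A w i j).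

Lemma measurable_mulmx m n p (A : T -> 'M[R]_(m, n)) (B : T -> 'M[R]_(n, p)) :
  measurable_mx A -> measurable_mx B -> measurable_mx (fun w => A w *m B w).
Proof.
move=> mA mB i j; under eq_fun do rewrite mxE.
by apply: measurable_sum => k; exact: measurable_funM.
Qed.

Lemma measurable_det n (A : T -> 'M[R]_n) : measurable_mx A ->
  measurable_fun [set: T] (fun w => \det (A w)).
Proof.
move=> mA; rewrite /determinant; apply: measurable_sum => s.
by apply: measurable_funM => //; apply: measurable_prod => i _; exact: mA.
Qed.

Lemma measurable_cramer n (A : T -> 'M[R]_n) : measurable_mx A ->
  measurable_mx (fun w => (\det (A w))^-1 *: \adj (A w)).
Proof.
move=> mA i j; under eq_fun do rewrite !mxE.
apply: measurable_funM; first exact/measurable_invr/measurable_det.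
apply: measurable_funM => //; apply: measurable_det => k l.
by under eq_fun do rewrite !mxE; exact: mA.
Qed.

Lemma measurable_bw_mx n (lam : R) (x : T -> 'cV[R]_n) :
  (forall i, measurable_fun [set: T] (fun w => x w i 0)) ->
  measurable_mx (fun w => bw_mx lam (x w)).
Proof.
move=> mx i j; rewrite /bw_mx; under eq_fun do rewrite mxE [X in _ + X]mxE.
have mD : measurable_mx (fun w => diff2_mx (x w)).
  move=> k l; under eq_fun do rewrite mxE.
  have minv (a b : 'I_n) :
      measurable_fun [set: T] (fun w => (x w a 0 - x w b 0)^-1).
    by apply: measurable_invr; exact: measurable_funB.
  by apply: measurable_funM; [|apply: measurable_funB]; apply: measurable_funM.
have mW : measurable_mx (fun w => diag_mx (diff2_weight (x w))).
  move=> k l; under eq_fun do rewrite !mxE mulrb.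
  case: (k == l); last exact: measurable_cst.
  by apply: measurable_funM => //; exact: measurable_funB.
apply: measurable_funD => //; apply: measurable_funM => //.
apply: measurable_mulmx => //; apply: measurable_mulmx => // k l.
by under eq_fun do rewrite mxE; exact: mD.
Qed.

End MeasurableMatrix.

(** * Frobenius norm of the smoother *)

Section Trace.
Variables (R : realType) (n : nat).

(** Cramer's formula: unlike [invmx], it is measurable in [x] without a
    discussion of invertibility. *)
Definition smoother (lam : R) (x : 'cV[R]_n) : 'M[R]_n :=
  (\det (bw_mx lam x))^-1 *: \adj (bw_mx lam x).

Variables (lam : R) (x : 'cV[R]_n).
Hypothesis lam_gt0 : 0 < lam.
Hypothesis x_reg : regular_design x.

Lemma regular_sorted (i j : 'I_n) : (i <= j)%N -> x i 0 <= x j 0.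
Proof.
rewrite leq_eqVlt => /predU1P[/val_inj->//|ij].
by rewrite ltW// x_reg.1.
Qed.

Lemma smoother_inv : smoother lam x = invmx (bw_mx lam x).
Proof.
by rewrite /smoother /invmx bw_mx_unit// ?ltW//; exact: regular_sorted.
Qed.

Lemma nat_ext_incr k : (k.+1 < n)%N -> nat_ext x k < nat_ext x k.+1.
Proof.
move=> kn; have := x_reg.1 (Ordinal (ltnW kn)) (Ordinal kn) (ltnSn k).
by rewrite -!nat_extE.
Qed.

Lemma nat_ext_in k : (k < n)%N -> 0 < nat_ext x k < 1.
Proof. by move=> kn; have := x_reg.2 (Ordinal kn); rewrite -nat_extE. Qed.

(** The blocks are the cells of a regular grid with [m <= 2 * r] cells of mesh
    at most [1 / r]: the leverages contribute [8 * m <= 16 * r], and the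
    deviations from lines [10 * r], because the hypothesis on [lam] balances the
    two. *)
Lemma smoother_frobenius (r : R) : 1 <= r -> n%:R <= lam * r ^+ 4 ->
  \sum_k \sum_j smoother lam x k j ^+ 2 <= 26 * r.
Proof.
move=> r1 nr; pose m := (Num.truncn r).+1.
have r0 : 0 <= r by lra.
have /andP[m1 m2] := truncn_itv r0; rewrite -/m in m2.
have m_le : m%:R <= 2 * r by rewrite /m -natr1; lra.
have m_gt0 : 0 < m%:R :> R by rewrite ltr0n.
have cell_lt (i : 'I_n) : (Num.truncn (m%:R * x i 0)%R < m)%N.
  have /andP[x0 x1] := x_reg.2 i.
  rewrite truncn_lt_nat; last by rewrite mulr_ge0// ltW.
  by rewrite gtr_pMr.
pose blk i := Ordinal (cell_lt i); pose h : R := m%:R^-1.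
have h_ge0 : 0 <= h by rewrite invr_ge0.
have small (i j : 'I_n) : blk i = blk j -> nat_ext x j - nat_ext x i <= h.
  move=> /(congr1 val)/= eq_ij; rewrite !nat_extE /h.
  have /andP[xi0 _] := x_reg.2 i; have /andP[xj0 _] := x_reg.2 j.
  have mi0 : 0 <= m%:R * x i 0 by rewrite mulr_ge0// ltW.
  have mj0 : 0 <= m%:R * x j 0 by rewrite mulr_ge0// ltW.
  have /andP[i1 _] := truncn_itv mi0; have /andP[_ j2] := truncn_itv mj0.
  rewrite -eq_ij -natr1 in j2.
  by rewrite -[leRHS]mul1r ler_pdivlMr// mulrBl ![_ * m%:R]mulrC; lra.
have kap_ge0 i := eval_norm_ge0 blk (nat_ext x) lam_gt0 h_ge0 i.
have eval_le (theta : 'cV[R]_n) i :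
    theta i 0 ^+ 2 <= eval_norm blk (nat_ext x) lam h i *
    (sqnorm2 theta + lam * roughness x theta).
  have := eval_sqr_le nat_ext_incr lam_gt0 h_ge0 small (nat_ext theta) i.
  rewrite nat_extE -(roughness_bending _ x_reg.1).
  by under eq_bigr do rewrite nat_extE.
have := smoother_frobenius_le (ltW lam_gt0) regular_sorted kap_ge0 eval_le.
rewrite exchange_big/= smoother_inv => /le_trans; apply.
apply: le_trans (eval_norm_sum_le blk (nat_ext x) lam_gt0 h_ge0) _.
have : n%:R * (h ^+ 3 / lam) <= r.
  rewrite mulrA ler_pdivrMr//; apply: (@le_trans _ _ (lam * r ^+ 4 * h ^+ 3)).
    by rewrite ler_wpM2r// exprn_ge0.
  rewrite (_ : lam * _ * _ = r * lam * (r / m%:R) ^+ 3); last first.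
    by rewrite /h; field; rewrite gt_eqF.
  rewrite -[leRHS]mulr1; apply: ler_wpM2l; first by rewrite mulr_ge0// ltW.
  apply: exprn_ile1; first by rewrite divr_ge0.
  by rewrite ler_pdivrMr// mul1r ltW.
rewrite -[10 * _ * _]mulrA; move: (n%:R * _) => q; lra.
Qed.

End Trace.

(** * The noise seen through the random smoother *)

Section DesignNoise.
Context d (T : measurableType d) (R : realType) (P : probability T R).
Variables (n : nat) (K lam : R) (x : T -> 'cV[R]_n).
Variable eps : 'I_n -> {RV P >-> R}.
Hypothesis mx : forall i, measurable_fun [set: T] (fun w => x w i 0).
Hypothesis eps_ind : mutually_independent P eps.
Hypothesis eps_sub : forall i, subgaussian P K (eps i).
Hypothesis x_eps : independent_families P (fun i w => x w i 0) eps.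

(** The sigma-algebra of a family of variables is that of one tuple-valued map,
    to which [indep_section_le] applies. *)
Definition tuple_of (X : 'I_n -> T -> R) (w : T) : n.-tuple R :=
  [tuple X i w | i < n].

Definition col_of_tuple (t : n.-tuple R) : 'cV[R]_n := \col_i tnth t i.

Lemma measurable_tuple_of (X : 'I_n -> T -> R) :
  (forall i, measurable_fun [set: T] (X i)) ->
  measurable_fun [set: T] (tuple_of X).
Proof.
move=> mX; apply/measurable_fun_tnthP => i.
by rewrite (_ : _ \o _ = X i)//; apply/funext => w; rewrite /= tnth_mktuple.
Qed.

Lemma preimage_tuple_of (X : 'I_n -> T -> R) (A : set (n.-tuple R)) :
  measurable A -> g_sigma_preimage X (tuple_of X @^-1` A).
Proof.
move=> mA.
have XE : (fun i => (fun t : n.-tuple R => tnth t i) \o tuple_of X) = X.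
  by apply/funext => i; apply/funext => w; rewrite /= tnth_mktuple.
have := @g_sigma_preimage_comp _ _ n (n.-tuple R)
  (fun i (t : n.-tuple R) => tnth t i) T (tuple_of X).
by rewrite XE => ->; exists A => //; rewrite setTI.
Qed.

Definition noisy (z : n.-tuple R * n.-tuple R) : 'cV[R]_n :=
  smoother lam (col_of_tuple z.1) *m col_of_tuple z.2.

Lemma measurable_noisy i :
  measurable_fun [set: n.-tuple R * n.-tuple R] (fun z => noisy z i 0).
Proof.
have m1 j : measurable_fun [set: n.-tuple R * n.-tuple R]
    (fun z => col_of_tuple z.1 j 0).
  under eq_fun do rewrite mxE.
  exact: (measurableT_comp (measurable_tnth j) measurable_fst).
apply: measurable_mulmx.
  by apply: measurable_cramer; exact: measurable_bw_mx.
move=> j k; under eq_fun do rewrite mxE.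
exact: (measurableT_comp (measurable_tnth j) measurable_snd).
Qed.

Lemma design_noise_tail (K1 tau u : R) :
  0 < K1 -> K ^+ 2 <= K1 -> 0 < tau -> 0 <= u ->
  (forall w, regular_design (x w) ->
     \sum_k \sum_j smoother lam (x w) k j ^+ 2 <= tau) ->
  (P [set w | regular_design (x w) /\
      (u < sqnorm2 (smoother lam (x w) *m (\col_i eps i w)))%R] <=
    (exp_moment_cst R * expR (- (u / (4 * K1 * tau))))%:E)%E.
Proof.
move=> K10 KK1 tau0 u0 frob.
pose f := tuple_of (fun i w => x w i 0); pose g := tuple_of eps.
have fE w : col_of_tuple (f w) = x w.
  by apply/colP => i; rewrite mxE tnth_mktuple.
have gE w : col_of_tuple (g w) = \col_i eps i w.
  by apply/colP => i; rewrite !mxE tnth_mktuple.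
pose E : set (n.-tuple R * n.-tuple R) :=
  [set z | regular_design (col_of_tuple z.1)] `&`
  [set z | u < sqnorm2 (noisy z)].
have mE : measurable E.
  apply: measurableI.
    apply: measurable_regular_design => i; under eq_fun do rewrite mxE.
    exact: (measurableT_comp (measurable_tnth i) measurable_fst).
  apply: measurable_superlevel; apply: measurable_sum => i.
  by apply: measurable_funX; exact: measurable_noisy.
have -> : [set w | regular_design (x w) /\
    u < sqnorm2 (smoother lam (x w) *m (\col_i eps i w))] =
    [set w | E (f w, g w)].
  by apply/seteqP; split => w; rewrite /E /noisy/= fE gE.
apply: (@indep_section_le _ _ _ P _ _ _ _ f g E) => //.
- exact: measurable_tuple_of.
- exact: measurable_tuple_of.
- by move=> A B mA mB; apply: x_eps; exact: preimage_tuple_of.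
move=> w; have [reg|nreg] := pselect (regular_design (x w)); last first.
  rewrite (_ : [set w' | _] = set0) ?measure0.
    by rewrite lee_fin mulr_ge0 ?expR_ge0// ltW// exp_moment_cst_gt0.
  by apply/seteqP; split => // w' []; rewrite /= fE.
have -> : [set w' | E (f w, g w')] =
    [set w' | u < sqnorm2 (smoother lam (x w) *m (\col_i eps i w'))].
  apply/seteqP; split => w'; rewrite /E /noisy/= fE gE; first by case.
  by move=> ?; split.
by apply: (quadratic_tail eps_ind eps_sub) => //; exact: frob.
Qed.

End DesignNoise.

Lemma roughness_sample_le (R : realType) (n : nat) (x : 'cV[R]_n)
    (f g : R -> R) (B : R) :
  regular_design x -> {within `[0, 1], continuous f} -> weak_derivative 2 f g ->
  (\int[@lebesgue_measure R]_(t in `[0%R, 1%R]) (g t ^+ 2)%:E <= B%:E)%E ->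
  roughness x (map_mx f x) <= B.
Proof.
move=> reg fc wd gB.
have := bending_sample_le (nat_ext_incr reg) (nat_ext_in reg) fc wd gB.
rewrite (roughness_bending _ reg.1); congr (_ <= _).
have ext k : (k < n)%N -> nat_ext (map_mx f x) k = f (nat_ext x k).
  by move=> kn; rewrite !(nat_extE _ (Ordinal kn)) mxE.
by apply: eq_big_nat => k kn; rewrite /slope /= !ext//; lia.
Qed.

(** * The rate *)

Section Powers.
Variable R : realType.

Lemma powR_ge1 (a s : R) : 1 <= a -> 0 <= s -> 1 <= a `^ s.
Proof. by move=> a1 s0; rewrite -(powRr0 a) ler_powR. Qed.

Lemma powR_exprn (a s : R) k : 0 <= a -> a `^ (s * k%:R) = (a `^ s) ^+ k.
Proof. by move=> a0; rewrite powRrM powR_mulrn// powR_ge0. Qed.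

End Powers.

Unset Implicit Arguments.
Set Strict Implicit.

Theorem corollary4 (R : realType) (K : R) :
  exists (c1 c2 c3 : R) (n0 : nat),
    [/\ 0 < c1, 0 < c2, 0 < c3 & (0 < n0)%N] /\
    forall (c : R) (n : nat), c1 <= c -> (n0 <= n)%N ->
    forall (d : measure_display) (T : measurableType d) (P : probability T R)
      (U eps : 'I_n -> {RV P >-> R}) (f0 Df0 D2f0 : R -> R) (Cn : R),
    let x := order_statistics U in
    let y := fun w => map_mx f0 (x w) + \col_(i < n) eps i w in
    let lambda := 3 * c * n%:R `^ (1 / 5) * Cn `^ (- (8 / 5)) in
    mutually_independent P U ->
    identically_distributed U ->
    (forall i, continuous (cdf (U i))) ->
    (forall i, distribution P (U i) `[0, 1] = 1%E) ->
    mutually_independent P eps ->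
    independent_families P (fun i w => x w i 0) eps ->
    (forall i, ('E_P[eps i] = 0)%E) ->
    (forall i, ('V_P[eps i] = 1)%E) ->
    (forall i, subgaussian P K (eps i)) ->
    {within `[0, 1], continuous f0} ->
    weak_derivative 1 f0 Df0 ->
    weak_derivative 2 f0 D2f0 ->
    1 <= Cn ->
    (\int[@lebesgue_measure R]_(t in `[0%R, 1%R]) (D2f0 t ^+ 2)%:E
       <= (Cn ^+ 2)%:E)%E ->
    forall thetahat : T -> 'cV[R]_n,
    (forall w, strictly_increasing (x w) ->
       is_argmin (bw_criterion lambda (x w) (y w)) (thetahat w)) ->
    exists E : set T,
      [/\ measurable E,
          (forall w, E w ->
             n%:R^-1 * sqnorm2 (thetahat w - map_mx f0 (x w)) <=
             26 * c * n%:R `^ (- (4 / 5)) * Cn `^ (2 / 5))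
        & ((1 - expR (- (c2 * c)) - expR (- (c3 * Num.sqrt n%:R)))%:E
             <= P E)%E].
Proof.
(* [K] may vanish, hence the 1. The tail of [quadratic_tail] at [u = 11 * c * r]
   and [tau = 26 * r] has exponent [2 * c2 * c]; half of it absorbs the constant
   [C0], by the choice of the lower bound on [c]. *)
pose K1 := K ^+ 2 + 1; pose C0 := exp_moment_cst R.
have K1_gt0 : 0 < K1 by rewrite ltr_wpDl ?sqr_ge0.
have C0_gt0 : 0 < C0 by exact: exp_moment_cst_gt0.
pose c2 := 11 / (208 * K1).
have c2_gt0 : 0 < c2 by rewrite divr_gt0// mulr_gt0.
have c1_gt0 : 0 < 1 + C0 / c2 by rewrite addr_gt0// divr_gt0.
exists (1 + C0 / c2), c2, 1, 1%N; split; first by split.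
move=> c n c1c n_gt0 d T P U eps f0 Df0 D2f0 Cn x y lambda.
move=> U_ind _ U_cont U_in eps_ind x_eps _ _ eps_sub f0_cont _ f0_wd Cn1 f0_int.
move=> that that_min.
have c_ge1 : 1 <= c by apply: le_trans c1c; rewrite lerDl ltW// divr_gt0.
have n1 : 1 <= n%:R :> R by rewrite ler1n.
pose a := n%:R `^ (1 / 5) : R; pose b := Cn `^ (2 / 5).
have a1 : 1 <= a by apply: powR_ge1.
have b1 : 1 <= b by apply: powR_ge1.
have nE : n%:R = a ^+ 5 by rewrite -powR_exprn// mul1r mulVf// powRr1.
have CE : Cn ^+ 2 = b ^+ 5.
  rewrite -powR_exprn; last by lra.
  by rewrite (_ : 2 / 5 * 5%:R = 2%:R) ?powR_mulrn//; [lra|field].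
have lamE : lambda = 3 * c * a / b ^+ 4.
  rewrite /lambda powRN (_ : 8 / 5 = 2 / 5 * 4%:R); last by field.
  by rewrite powR_exprn//; lra.
have rateE : n%:R `^ (- (4 / 5)) = (a ^+ 4)^-1 :> R.
  by rewrite powRN (_ : 4 / 5 = 1 / 5 * 4%:R) ?powR_exprn//; field.
pose r := a * b.
have r1 : 1 <= r by rewrite -[leLHS]mulr1 ler_pM.
have lam_gt0 : 0 < lambda.
  by rewrite lamE divr_gt0 ?exprn_gt0// ?mulr_gt0//; lra.
have n_le : n%:R <= lambda * r ^+ 4.
  rewrite nE lamE (_ : _ * _ = 3 * c * a ^+ 5); last first.
    by rewrite /r; field; lra.
  by rewrite ler_peMl ?exprn_ge0//; lra.
have mx i : measurable_fun [set: T] (fun w => x w i 0).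
  by apply: measurable_order_statistics => j; exact: measurable_funP.
pose noise w := smoother lambda (x w) *m (\col_i eps i w).
(* Twice this, plus the bias [3 * c * r], stays below [26 * c * r]. *)
pose u := 11 * c * r.
pose G := [set w | regular_design (x w)].
pose Bad := [set w | regular_design (x w) /\ u < sqnorm2 (noise w)].
have mG : measurable G by exact: measurable_regular_design.
have mBad : measurable Bad.
  apply: measurableI => //; apply: measurable_superlevel.
  apply: measurable_sum => i; apply: measurable_funX; apply: measurable_mulmx.
    by apply: measurable_cramer; exact: measurable_bw_mx.
  by move=> j k; under eq_fun do rewrite mxE; exact: measurable_funP.
exists (G `\` Bad); split; first exact: measurableD.
  move=> w [/= reg notBad].
  have sorted := regular_sorted reg.
  have noise_le : sqnorm2 (noise w) <= u.
    by rewrite leNgt; apply/negP => lt; apply: notBad.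
  have risk := bw_risk_le (ltW lam_gt0) sorted (that_min w reg.1).
  have rough := roughness_sample_le reg f0_cont f0_wd f0_int.
  rewrite -smoother_inv// -/(noise w) in risk.
  have bias : lambda * roughness (x w) (map_mx f0 (x w)) <= 3 * c * r.
    apply: le_trans (ler_wpM2l (ltW lam_gt0) rough) _.
    rewrite lamE CE.
    have -> : 3 * c * a / b ^+ 4 * b ^+ 5 = 3 * c * r by rewrite /r; field; lra.
    by [].
  rewrite rateE -/b ler_pdivrMl ?(lt_le_trans ltr01)// nE.
  rewrite (_ : a ^+ 5 * _ = 26 * c * r); last by rewrite /r; field; lra.
  apply: le_trans risk _.
  apply: le_trans (lerD bias (ler_wpM2l _ noise_le)) _ => //.
  have : 0 <= c * r by rewrite mulr_ge0//; lra.
  rewrite /u; lra.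
have PBad : (P Bad <= (expR (- (c2 * c)))%:E)%E.
  have tau0 : 0 < 26 * r by lra.
  have u0 : 0 <= u by rewrite /u !mulr_ge0//; lra.
  have KK1 : K ^+ 2 <= K1 by rewrite lerDl.
  have frob w : regular_design (x w) ->
      \sum_k \sum_j smoother lambda (x w) k j ^+ 2 <= 26 * r.
    by move=> reg; exact: smoother_frobenius.
  have := design_noise_tail mx eps_ind eps_sub x_eps K1_gt0 KK1 tau0 u0 frob.
  move=> /le_trans; apply.
  rewrite lee_fin -/C0 (_ : u / _ = 2 * (c2 * c)); last first.
    by rewrite /u /c2; field; rewrite !gt_eqF//; lra.
  have C0_le : C0 <= expR (c2 * c).
    apply: le_trans (expR_ge1Dx _).
    have := ler_wpM2l (ltW c2_gt0) c1c.
    by rewrite mulrDr mulr1 mulrCA divff ?gt_eqF// mulr1; lra.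
  rewrite mulr_natl mulr2n opprD expRD mulrA ler_piMl ?expR_ge0//.
  by rewrite expRN ler_pdivrMr ?expR_gt0// mul1r.
have PG : P (~` G) = 0%E.
  apply: measure_negligible; first exact: measurableC.
  exact: regular_design_ae.
have -> : G `\` Bad = ~` (~` G `|` Bad) by rewrite setCU setCK setDE.
rewrite probability_setC; last by apply: measurableU => //; exact: measurableC.
have : (P (~` G `|` Bad) <= (expR (- (c2 * c)))%:E)%E.
  apply: le_trans (measureU2 _ (measurableC mG) mBad) _.
  by rewrite -[leRHS]add0e; apply: leeD => //; rewrite -[leRHS]PG.
move=> le; apply: le_trans (leeB (lexx 1%E) le); rewrite -EFinB lee_fin.
by rewrite lerBlDr lerDl expR_ge0.
Qed.
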